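(* For a von Neumann algebra $\mathcal M$ the following statements are equivalent. (i) $\mathcal M$ is abelian. (ii) For every $\varphi\in\mathcal M_*^+$ the restriction of the norm topology to $[0,\varphi]$ is equal to $\tau_o[0,\varphi]$.
   Context: $\mathcal M_*^+$ is the cone of positive normal functionals in the predual $\mathcal M_*$. Hermitian normal functionals are partially ordered by $\varphi\le\psi$ iff $\varphi(x)\le\psi(x)$ for all positive $x\in\mathcal M$, and $[0,\varphi]$ is the set of $\psi\in\mathcal M_*$ with $0\le\psi\le\varphi$. $\tau_o[0,\varphi]$ is the order topology of the poset $[0,\varphi]$. Order topology: let $(P,\le)$ be a poset. For a net, $x_\gamma\uparrow x$ (resp. $x_\gamma\downarrow x$) means that the net is increasing with supremum $x$ in $P$ (resp. decreasing with infimum $x$ in $P$). A net $(x_\gamma)_{\gamma\in\Gamma}$ in $P$ order converges to $x\in P$ if there are nets $(y_\gamma)_{\gamma\in\Gamma}$, $(z_\gamma)_{\gamma\in\Gamma}$ in $P$ with $y_\gamma\le x_\gamma\le z_\gamma$ for all $\gamma$, $y_\gamma\uparrow x$ and $z_\gamma\downarrow x$. A subset $X\subset P$ is order-closed if no net in $X$ order converges to a point outside $X$. The order topology $\tau_o(P)$ is the topology whose closed sets are exactly the order-closed sets. *)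

(* Defs.v *)
From HB Require Import structures.
From mathcomp Require Import all_boot all_order all_algebra.
From mathcomp Require Import all_classical all_reals all_analysis.
From mathcomp Require Import complex ring.

Set Implicit Arguments.
Unset Strict Implicit.
Unset Printing Implicit Defensive.

Import Order.TTheory GRing.Theory Num.Theory.
Import numFieldNormedType.Exports.

Local Open Scope classical_set_scope.
Local Open Scope complex_scope.
Local Open Scope ring_scope.

Section OrderTopology.
Context {d : Order.disp_t} {P : porderType d}.

(* Nonemptiness is part of the definition of a directed set. *)
Definition directed d' (G : preorderType d') : Prop :=
  inhabited G /\ forall a b : G, exists c : G, (a <= c)%O /\ (b <= c)%O.

Definition increases_to d' (G : preorderType d') (y : G -> P) (x : P) : Prop :=
  {homo y : a b / (a <= b)%O >-> (a <= b)%O} /\ supremums (range y) x.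

Definition decreases_to d' (G : preorderType d') (z : G -> P) (x : P) : Prop :=
  {homo z : a b / (a <= b)%O >-> (b <= a)%O} /\ infimums (range z) x.

Definition order_converges d' (G : preorderType d') (u : G -> P) (x : P) :
    Prop :=
  exists y z : G -> P,
    [/\ forall g, (y g <= u g)%O /\ (u g <= z g)%O,
        increases_to y x & decreases_to z x].

Definition order_closed (X : set P) : Prop :=
  forall d' (G : preorderType d') (u : G -> P) (x : P),
    directed G -> (forall g, X (u g)) -> order_converges u x -> X x.

End OrderTopology.

(* The order topology, as the family of its open sets. *)
Definition order_opens d (P : porderType d) : set (set P) :=
  [set U | order_closed (~` U)].

(* [{dot E for _}] is linear in its first argument, conjugate-linear in its
   second one, Hermitian and positive definite. *)
Structure hilbertSpace (R : realType) := HilbertSpace {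
  hilbert_sort :> completeNormedModType R[i];
  inner : {dot hilbert_sort for (@Num.conj R[i])};
  inner_norm : forall v : hilbert_sort, inner v v = `|v| ^+ 2
}.

Section Operators.
Context {R : realType} {H : hilbertSpace R}.

Local Notation "''[' u , v ]" := (inner H u v).

Definition bounded_operator : set (H -> H) :=
  [set x | linear x /\ continuous x].

Definition adjoint_pair (x x' : H -> H) : Prop :=
  forall v w : H, '[x v, w] = '[v, x' w].

Definition commutant (S : set (H -> H)) : set (H -> H) :=
  [set x | bounded_operator x /\ forall y, S y -> x \o y = y \o x].

Definition positive_operator (x : H -> H) : Prop :=
  forall v : H, 0 <= '[x v, v].

End Operators.

Structure vonNeumannAlgebra (R : realType) (H : hilbertSpace R) := VNA {
  vna_set : set (H -> H);
  vna_bounded : vna_set `<=` bounded_operator;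
  vna_id : vna_set idfun;
  vna_lin : forall (a : R[i]) x y,
    vna_set x -> vna_set y -> vna_set (a *: x + y);
  vna_comp : forall x y, vna_set x -> vna_set y -> vna_set (x \o y);
  vna_adjoint : forall x, vna_set x ->
    exists2 x', vna_set x' & adjoint_pair x x';
  vna_bicommutant : commutant (commutant vna_set) = vna_set
}.

Section Elements.
Context {R : realType} {H : hilbertSpace R} (M : vonNeumannAlgebra H).

Record vna_elt := VNAElt {
  vna_op :> H -> H;
  vna_op_in : vna_op \in vna_set M
}.
HB.instance Definition _ := [isSub for vna_op].
HB.instance Definition _ := [Choice of vna_elt by <:].

Lemma vna_submod_closed : submod_closed [in vna_set M].
Proof.
split=> [|a x y]; rewrite !inE.
  have := vna_lin (-1) (vna_id M) (vna_id M).
  by rewrite scaleN1r addNr.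
exact: vna_lin.
Qed.

HB.instance Definition _ :=
  GRing.SubChoice_isSubLmodule.Build R[i] (H -> H) [in vna_set M] vna_elt
    vna_submod_closed.

End Elements.

Coercion vna_elt : vonNeumannAlgebra >-> Sortclass.

Definition abelian_vna (R : realType) (H : hilbertSpace R)
    (M : vonNeumannAlgebra H) : Prop :=
  forall x y : M, x \o y = y \o x.

Section Predual.
Context {R : realType} {H : hilbertSpace R} (M : vonNeumannAlgebra H).

Definition l2_seq : set (nat -> H) :=
  [set xi | cvgn (series (fun n => `|xi n| ^+ 2 : R[i]^o))].

Definition l2_functional (x : M) (p : l2_seq * l2_seq) : R[i] :=
  limn (series (fun n =>
    inner H (x (val p.1 n)) (val p.2 n) : R[i]^o)).

(* The sigma-weak topology: the coarsest one making all the functionals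
   x |-> \sum_n <x xi_n, eta_n> continuous, for square-summable xi, eta. *)
Definition sigma_weak : Type :=
  initial_topology (l2_functional : M -> {ptws (l2_seq * l2_seq)%type -> R[i]^o}).
HB.instance Definition _ := Topological.on sigma_weak.

Definition normal_functional : set (M -> R[i]) :=
  [set phi | scalar phi /\ continuous (phi : sigma_weak -> R[i]^o)].

Record predual := Predual {
  predual_fun :> M -> R[i];
  predual_normal : predual_fun \in normal_functional
}.
HB.instance Definition _ := [isSub for predual_fun].
HB.instance Definition _ := [Choice of predual by <:].

Definition positive_functional (phi : predual) : Prop :=
  forall x : M, positive_operator x -> 0 <= phi x.

(* Defined on bare functions, so as to apply to differences of elements of the
   predual. *)
Definition functional_norm (phi : M -> R[i]) : \bar R :=
  ereal_sup [set (complex.Re `|phi x|)%:E | x in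
    [set x : M | forall v : H, `|x v| <= `|v| ]].

(* The order of R[i] being [a <= b] iff [b - a] is a nonnegative real, this
   restricts to the usual order on Hermitian functionals. *)
Definition predual_le (phi psi : predual) : bool :=
  `[< forall x : M, positive_operator x -> phi x <= psi x >].

Lemma predual_le_refl : reflexive predual_le.
Proof. by move=> phi; apply/asboolP. Qed.

Lemma predual_le_trans : transitive predual_le.
Proof.
move=> psi phi chi /asboolP h1 /asboolP h2; apply/asboolP => x x0.
by apply: le_trans (h1 x x0) (h2 x x0).
Qed.

(* By polarization, every element of [M] is a linear combination of elements
   of the form a^* a. *)
Lemma scalar_eq0_pos (f : M -> R[i]) : scalar f ->
  (forall x : M, positive_operator x -> f x = 0) -> forall x : M, f x = 0.
Proof.
move=> lin_f f_pos x.
have fD (y z : M) : f (y + z) = f y + f z.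
  by rewrite -[y in LHS]scale1r lin_f mul1r.
have f0 : f 0 = 0 by apply: (addrI (f 0)); rewrite -fD !addr0.
have fZ a (y : M) : f (a *: y) = a * f y by rewrite -[a *: y]addr0 lin_f f0 addr0.
have fN (y : M) : f (- y) = - f y by rewrite -scaleN1r fZ mulN1r.
have [x' Mx' xx'] := vna_adjoint (set_mem (vna_op_in x)).
pose one : M := VNAElt (mem_set (vna_id M)).
pose y : M := VNAElt (mem_set Mx').
pose yx : M := VNAElt (mem_set (vna_comp Mx' (set_mem (vna_op_in x)))).
have key c : c * Num.conj c = 1 -> f yx + c * f y + Num.conj c * f x + f one = 0.
  move=> cc; rewrite -!fZ -!fD; apply: f_pos => v /=.
  suff -> : inner H (x' (x v) + c *: x' v + Num.conj c *: x v + v) v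
      = inner H (x v + c *: v) (x v + c *: v).
    by rewrite inner_norm exprn_ge0.
  have herm u w : inner H u w = Num.conj (inner H w u).
    by rewrite [LHS]hermC expr0 mul1r.
  have sw a b : inner H (x' a) b = inner H a (x b).
    by rewrite herm -xx' -herm.
  have iDl u w z : inner H (u + w) z = inner H u z + inner H w z.
    exact: linearDl.
  have iZl a u z : inner H (a *: u) z = a * inner H u z.
    exact: linearZl_LR.
  have iDr u w z : inner H z (u + w) = inner H z u + inner H z w.
    by rewrite herm iDl rmorphD [in RHS]herm (herm z w).
  have iZr a u z : inner H z (a *: u) = Num.conj a * inner H z u.
    by rewrite herm iZl rmorphM (herm z u).
  rewrite !(iDl, iDr, iZl, iZr) !sw.
  rewrite [c * (_ * _)]mulrA cc mul1r -!addrA; congr (_ + _).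
  by rewrite addrCA.
pose ci : R[i] := Complex 0 1.
have ci2 : ci * ci = -1 by rewrite -expr2 sqr_i.
have ciJ : Num.conj ci = - ci by apply/eqP; rewrite eq_complex /= oppr0 !eqxx.
have k1 : f yx + f y + f x + f one = 0.
  by have := key 1; rewrite rmorph1 !mul1r; apply.
have k2 : f yx - f y - f x + f one = 0.
  by have := key (-1); rewrite rmorphN rmorph1 mulrNN !mulN1r mul1r; apply.
have k3 : f yx + ci * f y - ci * f x + f one = 0.
  by have := key ci; rewrite ciJ mulNr mulrN ci2 opprK; apply.
have ci_neq0 : ci != 0.
  by apply/eqP => c0; move: ci2; rewrite c0 mul0r => /eqP;
     rewrite eq_sym oppr_eq0 oner_eq0.
have two_neq0 : 2 != 0 :> R[i] by rewrite pnatr_eq0.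
have fy : f y = - f x.
  apply/eqP; rewrite -subr_eq0 opprK -(mulrI_eq0 _ (mulfI two_neq0)); apply/eqP.
  rewrite -[RHS](subrr 0) -[X in _ = X - _]k1 -[X in _ = _ - X]k2; ring.
have yx0 : f yx + f one = 0 by rewrite -k1 fy; ring.
apply/eqP; rewrite -(mulrI_eq0 _ (mulfI two_neq0)).
rewrite -(mulrI_eq0 _ (mulfI ci_neq0)); apply/eqP.
rewrite -[RHS](subrr 0) -[X in _ = X - _]yx0 -[X in _ = _ - X]k3 fy; ring.
Qed.

Lemma predual_le_anti : antisymmetric predual_le.
Proof.
move=> phi psi /andP[/asboolP h1 /asboolP h2]; apply/val_inj/funext => x /=.
have [[lin_phi _] [lin_psi _]] :=
  (set_mem (predual_normal phi), set_mem (predual_normal psi)).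
apply/eqP; rewrite -subr_eq0; apply/eqP; move: x.
apply: (@scalar_eq0_pos (fun x => phi x - psi x)) => [a x y|x x0].
  by rewrite lin_phi lin_psi mulrBr opprD addrACA.
by apply/eqP; rewrite subr_eq0; apply/eqP/le_anti; rewrite h1 ?h2.
Qed.

Fact predual_display : Order.disp_t. Proof. exact: Order.Disp tt tt. Qed.

HB.instance Definition _ := Order.Le_isPOrder.Build predual_display predual
  predual_le_refl predual_le_anti predual_le_trans.

End Predual.

Section Interval.
Context {R : realType} {H : hilbertSpace R} {M : vonNeumannAlgebra H}.
Variable phi : predual M.

Record order_interval := OrderInterval {
  interval_fun :> predual M;
  interval_in : interval_fun \in
    [set psi : predual M | positive_functional psi /\ (psi <= phi)%O]
}.
HB.instance Definition _ := [isSub for interval_fun].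
HB.instance Definition _ := [Choice of order_interval by <:].
HB.instance Definition _ := 
  [SubChoice_isSubPOrder of order_interval by <: with predual_display].

(* The restriction of the norm topology of the predual to the interval, as the
   family of its open sets. *)
Definition norm_opens : set (set order_interval) :=
  [set U | forall psi : order_interval, U psi -> exists2 e : R, 0 < e &
    forall psi' : order_interval,
      (functional_norm (fun x : M => psi' x - psi x)%R < e%:E)%E -> U psi'].

End Interval.

Arguments order_opens {d} P.
Arguments norm_opens {R H M} phi.

(* Main.v *)
Require Import Defs.
From HB Require Import structures.
From mathcomp Require Import all_boot all_order all_algebra.
From mathcomp Require Import all_classical all_reals all_analysis.
From mathcomp Require Import complex ring lra.

Set Implicit Arguments.
Unset Strict Implicit.
Unset Printing Implicit Defensive.

Import Order.TTheory GRing.Theory Num.Theory.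
Import numFieldNormedType.Exports.

Local Open Scope classical_set_scope.
Local Open Scope complex_scope.
Local Open Scope ring_scope.

(* Order convergence in [0, phi] always implies norm convergence: a bounded
   increasing net of positive functionals converges pointwise, its limit h
   satisfies 0 <= h <= phi and is therefore normal (h is bounded for the seminorm
   of a GNS vector of phi, so Riesz represents it by a vector), hence h is the
   supremum, and the norm of a positive functional is its value at 1.

   If M is abelian and psi_k -> psi with ||psi_k - psi|| < 2^-k, then
   z_n = sup_(k >= n) psi_k exists in [0, phi]: it is the limit of mixtures
   sum_k psi_k(e_k . ) over partitions of unity (e_k) in M which nearly maximize
   the value at 1.  That value exceeds psi(1) by at most sum_(k >= n) 2^-k, so z_n
   decreases to psi; the reflection chi |-> phi - chi yields the lower sequence.

   If M is not abelian, it contains a nonzero a with a^2 = 0: otherwise every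
   projection of M is central, and repeatedly bisecting the spectrum of a
   self-adjoint x by kernel projections shows that x commutes with M.  Taking xi
   in the range of a^*, the vector functionals psi_t of xi + t a xi, 0 < t <= 1,
   form an order-closed set that is not norm-closed: a functional below both psi_0
   and psi_t, t <> 0, vanishes at a^* a a^* a, while psi_0 does not. *)

(** A supremum in [[0, phi]] is defined by the order alone and could a priori differ from the
    pointwise limit of the net. This is excluded because the pointwise limit is itself a member of
    the interval, which is why normality of dominated functionals carries the first half.

    In the abelian case norm convergence alone does not produce monotone bounds: the rates 2^-k are
    chosen to be summable, so that the envelope of a tail stays close to the limit. Commutativity
    enters through products: commuting positive elements have a positive product, so psi_k(e_k . )
    is again positive. Sequences are enough because the norm topology comes from a metric.

    In the other case, a^2 = 0 makes evaluation at a^* a linear coordinate t |a xi|^2 on the family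
    psi_t. Norm limits of the family therefore stay on the curve, and only t = 0 has to be excluded
    as an order limit; there the lower net vanishes at a positive element at which its supremum does
    not.

    Norms of vectors and scalars take values in [R[i]], so the estimates are made with real-valued
    squares. *)

Section Complex.
Context {R : realType}.
Implicit Types z w : R[i].

Definition sqn z : R := complex.Re z ^+ 2 + complex.Im z ^+ 2.

Lemma complexP z w :
  complex.Re z = complex.Re w -> complex.Im z = complex.Im w -> z = w.
Proof. by case: z w => a b [c d] /= -> ->. Qed.

Lemma ReD z w : complex.Re (z + w) = complex.Re z + complex.Re w.
Proof. by case: z w => a b [c d]. Qed.
Lemma ImD z w : complex.Im (z + w) = complex.Im z + complex.Im w.
Proof. by case: z w => a b [c d]. Qed.
Lemma ReN z : complex.Re (- z) = - complex.Re z.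
Proof. by case: z. Qed.
Lemma ImN z : complex.Im (- z) = - complex.Im z.
Proof. by case: z. Qed.
Lemma ReM z w : complex.Re (z * w) =
  complex.Re z * complex.Re w - complex.Im z * complex.Im w.
Proof. by case: z w => a b [c d]. Qed.
Lemma ImM z w : complex.Im (z * w) =
  complex.Re z * complex.Im w + complex.Im z * complex.Re w.
Proof. by case: z w => a b [c d]. Qed.
Lemma ReJ z : complex.Re (Num.conj z) = complex.Re z.
Proof. by case: z. Qed.
Lemma ImJ z : complex.Im (Num.conj z) = - complex.Im z.
Proof. by case: z. Qed.
Lemma Re_real (x : R) : complex.Re x%:C = x. Proof. by []. Qed.
Lemma Im_real (x : R) : complex.Im x%:C = 0. Proof. by []. Qed.

Definition ci : R[i] := Complex 0 1.
Lemma Re_ci : complex.Re ci = 0. Proof. by []. Qed.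
Lemma Im_ci : complex.Im ci = 1. Proof. by []. Qed.

Definition cE :=
  (ReD, ImD, ReN, ImN, ReM, ImM, ReJ, ImJ, Re_real, Im_real, Re_ci, Im_ci).

Lemma ge0_Re z : 0 <= z -> 0 <= complex.Re z.
Proof. by rewrite lecE => /andP[]. Qed.
Lemma ge0_Im z : 0 <= z -> complex.Im z = 0.
Proof. by rewrite lecE => /andP[/eqP]. Qed.
Lemma ge0_complexE z : 0 <= z -> z = (complex.Re z)%:C.
Proof. by move=> z0; apply: complexP => //=; rewrite ge0_Im. Qed.

Lemma sqn_ge0 z : 0 <= sqn z.
Proof. by rewrite addr_ge0 ?sqr_ge0. Qed.

Lemma sqnE z : z * Num.conj z = (sqn z)%:C.
Proof. by apply: complexP; rewrite !cE /sqn; ring. Qed.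

Lemma sqn_real (a : R) : sqn a%:C = a ^+ 2.
Proof. by rewrite /sqn /= expr0n addr0. Qed.

Lemma conj_real (a : R) : Num.conj a%:C = a%:C :> R[i].
Proof. by apply: complexP; rewrite !cE ?oppr0. Qed.

Lemma sqnM z w : sqn (z * w) = sqn z * sqn w.
Proof. by rewrite /sqn !cE; ring. Qed.
End Complex.
Global Opaque ci.

(** * Positive semidefinite forms *)

Section Form.
Context {R : realType} {V : lmodType R[i]}.
Variable q : V -> V -> R[i].

(** Degenerate forms are allowed, because the GNS forms below may have a kernel. Hermitian symmetry
    is derived in [form_herm]. *)
Definition psd_form := [/\ forall w, scalar (q^~ w),
  forall u a v w, q u (a *: v + w) = Num.conj a * q u v + q u w &
  forall u, 0 <= q u u].

Hypothesis qP : psd_form.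

Definition qf u : R := complex.Re (q u u).

Lemma qfE u : q u u = (qf u)%:C.
Proof. by case: qP => _ _ /(_ u) /ge0_complexE. Qed.
Lemma qf_ge0 u : 0 <= qf u.
Proof. by case: qP => _ _ /(_ u) /ge0_Re. Qed.

Lemma formDl u v w : q (u + v) w = q u w + q v w.
Proof. by case: qP => /(_ w 1 u v); rewrite scale1r mul1r. Qed.
Lemma formDr u v w : q w (u + v) = q w u + q w v.
Proof. by case: qP => _ /(_ w 1 u v); rewrite scale1r rmorph1 mul1r. Qed.
Lemma form0l w : q 0 w = 0.
Proof. by apply: (addrI (q 0 w)); rewrite -formDl !addr0. Qed.
Lemma form0r w : q w 0 = 0.
Proof. by apply: (addrI (q w 0)); rewrite -formDr !addr0. Qed.
Lemma formZl a u w : q (a *: u) w = a * q u w.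
Proof. by case: qP => /(_ w a u 0); rewrite !addr0 form0l addr0. Qed.
Lemma formZr a u w : q w (a *: u) = Num.conj a * q w u.
Proof. by case: qP => _ /(_ w a u 0); rewrite !addr0 form0r addr0. Qed.
Lemma formNl u w : q (- u) w = - q u w.
Proof. by rewrite -scaleN1r formZl mulN1r. Qed.
Lemma formNr u w : q w (- u) = - q w u.
Proof. by rewrite -scaleN1r formZr rmorphN rmorph1 mulN1r. Qed.

(** The diagonal values at [u + v] and at [u + ci *: v] are real; their imaginary parts give the two
    real equations. *)
Lemma form_herm u v : q u v = Num.conj (q v u).
Proof.
have [_ _ q0] := qP.
have := ge0_Im (q0 (u + v)); have := ge0_Im (q0 (u + ci *: v)).
rewrite !(formDl, formDr, formZl, formZr) (qfE u) (qfE v) !cE => h1 h2.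
apply: complexP; rewrite !cE; lra.
Qed.

Lemma qfD u v : qf (u + v) = qf u + qf v + 2 * complex.Re (q u v).
Proof. by rewrite /qf !(formDl, formDr) (form_herm v u) !cE; ring. Qed.

Lemma qfZ a u : qf (a *: u) = sqn a * qf u.
Proof. by rewrite /qf formZl formZr qfE !cE /sqn; ring. Qed.

Lemma qfB u v : qf (u - v) = qf u + qf v - 2 * complex.Re (q u v).
Proof. by rewrite /qf !(formDl, formDr, formNl, formNr) (form_herm v u) !cE; ring. Qed.

Lemma qfB_le u v : qf (u - v) <= 2 * (qf u + qf v).
Proof. by have := qf_ge0 (u + v); rewrite qfB qfD; lra. Qed.

Lemma qfD_le u v : qf (u + v) <= 2 * (qf u + qf v).
Proof. by have := qf_ge0 (u - v); rewrite qfB qfD; lra. Qed.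

Lemma form_polar u v : 4 * q u v = (qf (u + v))%:C - (qf (u - v))%:C
  + ci * (qf (u + ci *: v))%:C - ci * (qf (u - ci *: v))%:C.
Proof.
rewrite !qfB !qfD !formZr.
have -> : 4 = (4 : R)%:C :> R[i] by rewrite rmorph_nat.
by apply: complexP; rewrite !cE; ring.
Qed.
End Form.

Lemma ler_of_sqr {R : realType} (a b : R) : 0 <= b -> a ^+ 2 <= b ^+ 2 -> a <= b.
Proof.
move=> b0; have [a0 _|a0] := leP a 0; first exact: le_trans b0.
by rewrite ler_pXn2r // nnegrE // ltW.
Qed.

(** The quadratic in [t] is evaluated at its minimum [Q^-1]. When [Q = 0] it is affine, and a
    positive [W] would push it down to -1. *)
Lemma discr_le {R : realType} (d W Q : R) : 0 <= W -> 0 <= Q ->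
  (forall t, 0 <= d - 2 * t * W + t ^+ 2 * (W * Q)) -> W <= d * Q.
Proof.
move=> W0 Q0 h; have [Q_gt0|Q_le0] := ltP 0 Q.
  have := h Q^-1.
  have -> : d - 2 * Q^-1 * W + Q^-1 ^+ 2 * (W * Q) = (d * Q - W) / Q.
    by field; rewrite gt_eqF.
  by rewrite pmulr_lge0 ?invr_gt0 // subr_ge0.
have Q_eq0 : Q = 0 by apply/le_anti/andP.
rewrite Q_eq0 mulr0 leNgt; apply/negP => W_gt0.
have := h ((d + 1) / (2 * W)); rewrite Q_eq0 !mulr0 addr0.
have -> : d - 2 * ((d + 1) / (2 * W)) * W = -1 by field; rewrite gt_eqF.
lra.
Qed.

Section FormCS.
Context {R : realType} {V : lmodType R[i]} (q : V -> V -> R[i]).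
Hypothesis qP : psd_form q.

(** Choosing [s] as a real multiple of the conjugate of [w] reduces the condition to a real
    quadratic. This serves both Cauchy-Schwarz and the error estimate in [form_riesz]. *)
Lemma form_discr u (w : R[i]) d :
  (forall s : R[i], 0 <= d + 2 * complex.Re (s * w) + sqn s * qf q u) ->
  sqn w <= d * qf q u.
Proof.
move=> h; apply: discr_le (sqn_ge0 w) (qf_ge0 qP u) _ => t.
have := h (- (t%:C * Num.conj w)); rewrite /sqn !cE; lra.
Qed.

Lemma form_CS u v : sqn (q u v) <= qf q u * qf q v.
Proof.
rewrite [leRHS]mulrC; apply: form_discr => s.
have := qf_ge0 qP (s *: u + v); rewrite qfD // qfZ // formZl //.
lra.
Qed.
End FormCS.

Section FormRiesz.
Context {R : realType} {V : lmodType R[i]} (q : V -> V -> R[i]).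
Hypothesis qP : psd_form q.
Variables (h : V -> R[i]) (B : R).
Hypotheses (h_lin : scalar h) (B0 : 0 <= B).
Hypothesis h_bnd : forall u, sqn (h u) <= B * qf q u.

(* A Riesz representation that does not need [V] to be complete: [x] minimizes
   [q u u - 2 Re (h u)]. *)
Lemma form_riesz : exists x : nat -> V,
  (forall j k, qf q (x j - x k) <= 2 * (j.+1%:R^-1 + k.+1%:R^-1)) /\
  (forall k u, sqn (h u - q u (x k)) <= k.+1%:R^-1 * qf q u).
Proof.
pose J u := qf q u - 2 * complex.Re (h u).
have hD u v : h (u + v) = h u + h v by rewrite -[u]scale1r h_lin mul1r scale1r.
have h0 : h 0 = 0 by apply: (addrI (h 0)); rewrite -hD !addr0.
have hZ a u : h (a *: u) = a * h u by rewrite -[_ *: u]addr0 h_lin h0 addr0.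
(* From |h u|^2 <= B q(u,u) and the arithmetic-geometric mean inequality, 2 Re (h u) <= q(u,u) +
   B. *)
have J_lb u : - B <= J u.
  have := h_bnd u; rewrite /J /sqn => hu; have q0 := qf_ge0 qP u.
  have Im0 := sqr_ge0 (complex.Im (h u)).
  have : (2 * complex.Re (h u)) ^+ 2 <= (qf q u + B) ^+ 2.
    by have := sqr_ge0 (qf q u - B); lra.
  by move=> /(ler_of_sqr (addr_ge0 q0 B0)); lra.
pose S := range J.
have Sinf : has_inf S by split; [exists (J 0), 0|exists (- B) => _ [u _ <-]].
pose m := inf S.
have mJ u : m <= J u by apply: ge_inf; [case: Sinf|exists u].
have exx k : exists u, J u < m + k.+1%:R^-1.
  have k0 : 0 < k.+1%:R^-1 :> R by rewrite invr_gt0 ltr0Sn.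
  by have [_ [u _ <-]] := inf_adherent k0 Sinf; exists u.
pose x k := projT1 (cid (exx k)).
have xP k : J (x k) < m + k.+1%:R^-1 by rewrite /x; case: cid.
exists x; split=> [j k|k u].
  (* Parallelogram law at the midpoint: q(x_j - x_k) = 2 J(x_j) + 2 J(x_k) - 4 J(midpoint), because
     the linear parts cancel. *)
  have := mJ ((2^-1 : R)%:C *: (x j + x k)); move: (xP j) (xP k).
  rewrite /J qfZ // qfD // qfB // hZ hD /sqn !cE expr0n addr0.
  have -> : (2^-1 : R) ^+ 2 = 4^-1 by rewrite exprVn -natrX.
  by move: (j.+1%:R^-1) (k.+1%:R^-1) => dj dk; lra.
(* Moving the near-minimizer [x k] by a multiple of [u] lowers [J] by less than 1/(k+1). This is the
   hypothesis of [form_discr] for [h u - q u (x k)]. *)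
apply: form_discr => // s.
have := mJ ((- s) *: u + x k); move: (xP k).
rewrite /J qfD // qfZ // hD hZ formZl // /sqn !cE.
by move: (k.+1%:R^-1) => d; lra.
Qed.
End FormRiesz.

(** * Complex limits through squared moduli and through real and imaginary parts *)

Section Limits.
Context {R : realType}.

Lemma gt0_complexE (e : R[i]) : 0 < e -> e = (complex.Re e)%:C /\ 0 < complex.Re e.
Proof.
move=> e0; have eE := ge0_complexE (ltW e0); split=> //.
by move: e0; rewrite {1}eE ltcR.
Qed.

Lemma normC_sqn (z : R[i]) : `|z| = (Num.sqrt (sqn z))%:C.
Proof. exact: normc_def. Qed.

Lemma cvgC_sqn {T} {F : set_system T} {FF : Filter F} (f : T -> R[i]) (l : R[i]) :
  (f : T -> R[i]^o) @ F --> (l : R[i]^o) <->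
  (fun x => sqn (f x - l)) @ F --> (0 : R).
Proof.
split=> [/cvgrPdistC_lt h|h].
  apply/cvgrPdistC_lt => e e0.
  have e1 : 0 < (Num.sqrt e)%:C :> R[i] by rewrite ltcR sqrtr_gt0.
  have := h _ e1; apply: filterS => i; rewrite normC_sqn ltcR ltr_sqrt//.
  by rewrite subr0 ger0_norm ?sqn_ge0.
apply/cvgrPdistC_lt => e /gt0_complexE[-> e0].
have /(cvgr_lt _ h) : 0 < complex.Re e ^+ 2 by rewrite exprn_gt0.
apply: filterS => i hi; rewrite normC_sqn ltcR.
by rewrite -ltr_sqr ?nnegrE ?sqrtr_ge0 ?ltW// sqr_sqrtr ?sqn_ge0.
Qed.

Lemma cvgC_ReIm {T} {F : set_system T} {FF : Filter F} (f : T -> R[i]) (l : R[i]) :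
  (fun x => complex.Re (f x)) @ F --> complex.Re l ->
  (fun x => complex.Im (f x)) @ F --> complex.Im l ->
  (f : T -> R[i]^o) @ F --> (l : R[i]^o).
Proof.
move=> fRe fIm; apply/cvgC_sqn.
have sub0 (g : T -> R) (a : R) : g @ F --> a -> (fun x => (g x - a) ^+ 2) @ F --> (0 : R).
  move=> ga; have : (fun x => g x - a) @ F --> (0 : R).
    by rewrite -(subrr a); apply: cvgB => //; exact: cvg_cst.
  by move=> h; rewrite -[X in _ --> X](mul0r 0); under eq_fun do rewrite expr2; exact: cvgM.
rewrite -[X in _ --> X](addr0 0).
under eq_fun do rewrite /sqn ReD ImD ReN ImN.
exact: cvgD (sub0 _ _ fRe) (sub0 _ _ fIm).
Qed.

Lemma cvgC_Re {T} {F : set_system T} {FF : Filter F} (f : T -> R[i]) (l : R[i]) :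
  (f : T -> R[i]^o) @ F --> (l : R[i]^o) ->
  (fun x => complex.Re (f x)) @ F --> complex.Re l.
Proof.
move=> /cvgC_sqn h; apply/cvgrPdistC_lt => e e0.
have /(cvgr_lt _ h) : 0 < e ^+ 2 by rewrite exprn_gt0.
apply: filterS => x hx; rewrite -ltr_sqr ?nnegrE ?(ltW e0) //.
rewrite real_normK ?num_real//; apply: le_lt_trans hx.
by rewrite /sqn ReD ReN lerDl sqr_ge0.
Qed.

Lemma cvgC_Im {T} {F : set_system T} {FF : Filter F} (f : T -> R[i]) (l : R[i]) :
  (f : T -> R[i]^o) @ F --> (l : R[i]^o) ->
  (fun x => complex.Im (f x)) @ F --> complex.Im l.
Proof.
move=> /cvgC_sqn h; apply/cvgrPdistC_lt => e e0.
have /(cvgr_lt _ h) : 0 < e ^+ 2 by rewrite exprn_gt0.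
apply: filterS => x hx; rewrite -ltr_sqr ?nnegrE ?(ltW e0) //.
rewrite real_normK ?num_real//; apply: le_lt_trans hx.
by rewrite /sqn ImD ImN lerDr sqr_ge0.
Qed.

Lemma toC_cvg {T} {F : set_system T} {FF : Filter F} (g : T -> R) (l : R) :
  g @ F --> l -> (fun i => (g i)%:C : R[i]^o) @ F --> (l%:C : R[i]^o).
Proof. by move=> gl; apply: cvgC_ReIm => //=; exact: cvg_cst. Qed.

Lemma cvg_half : (fun n => 2^-1 ^+ n : R) @ \oo --> (0 : R).
Proof. by apply: cvg_expr; rewrite ger0_norm ?invr_ge0 // invf_lt1 // ltr1n. Qed.
End Limits.

(** * Hilbert space estimates with squared norms *)

Section Hilbert.
Context {R : realType} {H : hilbertSpace R}.
Implicit Types u v w : H.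

Lemma inner_psd : psd_form (inner H).
Proof.
have herm u w : inner H u w = Num.conj (inner H w u).
  by rewrite [LHS]hermC expr0 mul1r.
have lin w : scalar (inner H ^~ w).
  by move=> a u v /=; rewrite linearDl linearZl_LR.
split; first exact: lin.
  move=> u a v w; rewrite herm [inner H (_ + _) _](lin u a v w).
  by rewrite rmorphD rmorphM /= [in RHS]herm (herm u w).
by move=> u; rewrite inner_norm exprn_ge0.
Qed.

Definition nsq v := qf (inner H) v.

Lemma nsqE v : (nsq v)%:C = `|v| ^+ 2.
Proof. by rewrite -inner_norm -qfE //; exact: inner_psd. Qed.

Lemma norm_nsq v : `|v| = (Num.sqrt (nsq v))%:C.
Proof.
have n0 := ge0_complexE (normr_ge0 v).
have : (nsq v)%:C = (complex.Re `|v| ^+ 2)%:C by rewrite nsqE n0 rmorphXn.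
move=> /complexI ->.
by rewrite sqrtr_sqr ger0_norm // ge0_Re.
Qed.

Lemma nsq_ge0 v : 0 <= nsq v. Proof. exact: qf_ge0 inner_psd v. Qed.

Lemma nsq_eq0 v : nsq v = 0 -> v = 0.
Proof. by move=> v0; apply/eqP; rewrite -normr_eq0 norm_nsq v0 sqrtr0. Qed.

Lemma nsq0 : nsq (0 : H) = 0.
Proof. by rewrite /nsq /qf form0l //; exact: inner_psd. Qed.

Lemma norm_le_nsq u v : (`|u| <= `|v|) = (nsq u <= nsq v).
Proof. by rewrite !norm_nsq lecR ler_sqrt // nsq_ge0. Qed.

Lemma cvgH_nsq {T} {F : set_system T} {FF : Filter F} (u : T -> H) l :
  u @ F --> l <-> (fun i => nsq (u i - l)) @ F --> (0 : R).
Proof.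
split=> [/cvgrPdistC_lt h|h].
  apply/cvgrPdistC_lt => e e0.
  have e1 : 0 < (Num.sqrt e)%:C :> R[i] by rewrite ltcR sqrtr_gt0.
  have := h _ e1; apply: filterS => i; rewrite norm_nsq ltcR ltr_sqrt//.
  by rewrite subr0 ger0_norm ?nsq_ge0.
apply/cvgrPdistC_lt => e /gt0_complexE[-> e0].
have /(cvgr_lt _ h) : 0 < complex.Re e ^+ 2 by rewrite exprn_gt0.
apply: filterS => i hi; rewrite norm_nsq ltcR.
by rewrite -ltr_sqr ?nnegrE ?sqrtr_ge0 ?ltW// sqr_sqrtr ?nsq_ge0.
Qed.

Lemma cauchyH (u : nat -> H) :
  (forall e : R, 0 < e -> exists N, forall m n, (N <= m)%N -> (N <= n)%N ->
     nsq (u m - u n) < e) -> cvgn u.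
Proof.
move=> h; apply/cauchy_cvgP/cauchy_exP => e /gt0_complexE[-> e0].
have [|N hN] := h (complex.Re e ^+ 2); first by rewrite exprn_gt0.
exists (u N); exists N => //= n /= Nn.
rewrite -ball_normE /= norm_nsq ltcR.
by rewrite -ltr_sqr ?nnegrE ?sqrtr_ge0 ?ltW// sqr_sqrtr ?nsq_ge0// hN.
Qed.

Lemma inner_cvg {T} {F : set_system T} {FF : Filter F} (u : T -> H) l w :
  u @ F --> l -> (fun i => inner H (u i) w : R[i]^o) @ F --> (inner H l w : R[i]^o).
Proof.
move=> /cvgH_nsq h; apply/cvgC_sqn.
have : (fun i => nsq (u i - l) * nsq w) @ F --> (0 : R).
  by rewrite -[X in _ --> X](mul0r (nsq w)); apply: cvgMr_tmp.
apply: squeeze_cvgr (@cvg_cst _ _ _ _ _); near=> i.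
rewrite sqn_ge0 /= -(formNl inner_psd) -(formDl inner_psd).
exact: form_CS inner_psd _ _.
Unshelve. all: by end_near. Qed.

Lemma linear_bounded_nsq (x : H -> H) : bounded_operator x ->
  exists2 K : R, 0 <= K & forall v, nsq (x v) <= K * nsq v.
Proof.
move=> [lx cx].
pose xL : {linear H -> H} := HB.pack x (GRing.isLinear.Build _ _ _ _ x lx).
have /linear_boundedP/pinfty_ex_gt0[K K0 hK] : bounded_near xL (nbhs 0).
  exact/linear_bounded_continuous.
have [KE K1] := gt0_complexE K0.
exists (complex.Re K ^+ 2) => [|v]; first exact: sqr_ge0.
rewrite -lecR rmorphM rmorphXn /= -KE !nsqE -exprMn.
by rewrite lerXn2r ?nnegrE ?mulr_ge0 // ltW.
Qed.

Lemma nsq_bounded_operator (x : H -> H) (K : R) : linear x ->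
  (forall v, nsq (x v) <= K * nsq v) -> bounded_operator x.
Proof.
move=> lx hK; split=> // v; apply/cvgH_nsq.
have hv : (fun i : H => nsq (i - v)) @ v --> (0 : R) by apply/cvgH_nsq.
have : (fun i => K * nsq (i - v)) @ v --> (0 : R).
  by rewrite -[X in _ --> X](mulr0 K); apply: cvgMl_tmp.
apply: squeeze_cvgr (@cvg_cst _ _ _ _ _); near=> i.
rewrite nsq_ge0 /= -scaleN1r addrC -lx scaleN1r addrC; exact: hK.
Unshelve. all: by end_near. Qed.
End Hilbert.

(** * Elements and functionals of a von Neumann algebra *)

Section Algebra.
Context {R : realType} {H : hilbertSpace R} (M : vonNeumannAlgebra H).
Implicit Types (x y z : M) (u v w : H).

Lemma vna_ext x y : (forall v, x v = y v) -> x = y.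
Proof. by move=> h; apply/val_inj/funext. Qed.

Lemma vna_in x : vna_set M x. Proof. exact: set_mem (vna_op_in x). Qed.

Definition vmul x y : M := VNAElt (mem_set (vna_comp (vna_in x) (vna_in y))).
Definition vone : M := VNAElt (mem_set (vna_id M)).
Definition vadj x : M :=
  VNAElt (mem_set (s2valP (cid2 (vna_adjoint (vna_in x))))).

Lemma vmulE x y v : vmul x y v = x (y v). Proof. by []. Qed.
Lemma voneE v : vone v = v. Proof. by []. Qed.
Lemma vaddE x y v : (x + y) v = x v + y v. Proof. by []. Qed.
Lemma vscaleE (a : R[i]) x v : (a *: x) v = a *: x v. Proof. by []. Qed.
Lemma voppE x v : (- x) v = - x v. Proof. by []. Qed.
Lemma vzeroE v : (0 : M) v = 0. Proof. by []. Qed.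

Definition vE := (vmulE, voneE, vaddE, vscaleE, voppE, vzeroE).

Lemma vlin x (a : R[i]) u v : x (a *: u + v) = a *: x u + x v.
Proof. by have [+ _] := vna_bounded (vna_in x); apply. Qed.
Lemma vD x u v : x (u + v) = x u + x v.
Proof. by rewrite -[u in LHS]scale1r vlin scale1r. Qed.
Lemma v0 x : x 0 = 0.
Proof. by apply: (addrI (x 0)); rewrite -vD !addr0. Qed.
Lemma vZ x (a : R[i]) u : x (a *: u) = a *: x u.
Proof. by rewrite -[a *: u in LHS]addr0 vlin v0 addr0. Qed.
Lemma vN x u : x (- u) = - x u.
Proof. by rewrite -scaleN1r vZ scaleN1r. Qed.

Definition vopE := (vD, v0, vZ, vN).

Lemma innerDl u v w : inner H (u + v) w = inner H u w + inner H v w.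
Proof. exact: formDl inner_psd _ _ _. Qed.
Lemma innerDr u v w : inner H w (u + v) = inner H w u + inner H w v.
Proof. exact: formDr inner_psd _ _ _. Qed.
Lemma innerZl (a : R[i]) v w : inner H (a *: v) w = a * inner H v w.
Proof. exact: formZl inner_psd _ _ _. Qed.
Lemma innerZr (a : R[i]) v w : inner H w (a *: v) = Num.conj a * inner H w v.
Proof. exact: formZr inner_psd _ _ _. Qed.
Lemma innerNl v w : inner H (- v) w = - inner H v w.
Proof. exact: formNl inner_psd _ _. Qed.
Lemma innerNr v w : inner H w (- v) = - inner H w v.
Proof. exact: formNr inner_psd _ _. Qed.
Lemma innerC v w : inner H v w = Num.conj (inner H w v).
Proof. exact: form_herm inner_psd _ _. Qed.
Lemma inner0l w : inner H 0 w = 0.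
Proof. exact: form0l inner_psd _. Qed.

Definition innerE := (innerDl, innerDr, innerZl, innerZr, innerNl, innerNr).

Lemma inner_inj v w : (forall u, inner H u v = inner H u w) -> v = w.
Proof.
move=> h; apply/eqP; rewrite -subr_eq0; apply/eqP/nsq_eq0.
by rewrite /nsq /qf innerDr h innerNr subrr.
Qed.

Lemma vadjP x v w : inner H (x v) w = inner H v (vadj x w).
Proof. exact: (s2valP' (cid2 (vna_adjoint (vna_in x)))). Qed.

Lemma vadjP' x v w : inner H (vadj x v) w = inner H v (x w).
Proof. by rewrite innerC -vadjP -innerC. Qed.

Lemma vadj_uniq x y : (forall v w, inner H (x v) w = inner H v (y w)) -> vadj x = y.
Proof.
by move=> h; apply: vna_ext => w; apply: inner_inj => v; rewrite -vadjP h.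
Qed.

Lemma vadjK x : vadj (vadj x) = x.
Proof. by apply: vadj_uniq => v w; rewrite vadjP'. Qed.
Lemma vadj1 : vadj vone = vone.
Proof. exact: vadj_uniq. Qed.
Lemma vadjD x y : vadj (x + y) = vadj x + vadj y.
Proof. by apply: vadj_uniq => v w; rewrite !vE !innerE !vadjP. Qed.
Lemma vadjZ a x : vadj (a *: x) = Num.conj a *: vadj x.
Proof. by apply: vadj_uniq => v w; rewrite !vE !innerE !vadjP conjCK. Qed.
Lemma vadjM x y : vadj (vmul x y) = vmul (vadj y) (vadj x).
Proof. by apply: vadj_uniq => v w; rewrite !vE !vadjP. Qed.
Lemma vadjN x : vadj (- x) = - vadj x.
Proof. by apply: vadj_uniq => v w; rewrite !vE !innerE !vadjP. Qed.

Definition vadjE := (vadjK, vadj1, vadjD, vadjZ, vadjM, vadjN).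

Lemma vmulA x y z : vmul x (vmul y z) = vmul (vmul x y) z. Proof. exact: vna_ext. Qed.
Lemma vmul1l x : vmul vone x = x. Proof. exact: vna_ext. Qed.
Lemma vmul1r x : vmul x vone = x. Proof. exact: vna_ext. Qed.
Lemma vmulDl x y z : vmul (x + y) z = vmul x z + vmul y z. Proof. exact: vna_ext. Qed.
Lemma vmulDr x y z : vmul z (x + y) = vmul z x + vmul z y.
Proof. by apply: vna_ext => v; rewrite !vE !vopE. Qed.
Lemma vmulZl a x y : vmul (a *: x) y = a *: vmul x y. Proof. exact: vna_ext. Qed.
Lemma vmulZr a x y : vmul y (a *: x) = a *: vmul y x.
Proof. by apply: vna_ext => v; rewrite !vE !vopE. Qed.
Lemma vmulNl x y : vmul (- x) y = - vmul x y. Proof. exact: vna_ext. Qed.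
Lemma vmulNr x y : vmul y (- x) = - vmul y x.
Proof. by apply: vna_ext => v; rewrite !vE !vopE. Qed.
Lemma vmul0l x : vmul 0 x = 0. Proof. exact: vna_ext. Qed.
Lemma vmul0r x : vmul x 0 = 0.
Proof. by apply: vna_ext => v; rewrite !vE !vopE. Qed.

Definition vmul_lin := (vmulDl, vmulDr, vmulZl, vmulZr, vmulNl, vmulNr, vmul0l, vmul0r).

Lemma positive_adjM x : positive_operator (vmul (vadj x) x).
Proof. by move=> v; rewrite vE vadjP' inner_norm exprn_ge0. Qed.

Lemma positive_add x y : positive_operator x -> positive_operator y ->
  positive_operator (x + y).
Proof. by move=> x0 y0 v; rewrite vE innerDl addr_ge0. Qed.

Lemma positive_scale (a : R) x : 0 <= a -> positive_operator x ->
  positive_operator (a%:C *: x).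
Proof. by move=> a0 x0 v; rewrite vE innerZl mulr_ge0 // lecR. Qed.

Lemma positive_one : positive_operator vone.
Proof. by move=> v; rewrite inner_norm exprn_ge0. Qed.

Lemma vbounded x : exists2 K : R, 0 < K & forall v, nsq (x v) <= K ^+ 2 * nsq v.
Proof.
have [K K0 hK] := linear_bounded_nsq (vna_bounded (vna_in x)).
exists (K + 1) => [|v]; first by rewrite ltr_wpDl.
apply: le_trans (hK v) _; apply: ler_wpM2r; first exact: nsq_ge0.
by nra.
Qed.

Lemma bounded_inner_le x (K : R) v : 0 <= K ->
  (forall v, nsq (x v) <= K ^+ 2 * nsq v) ->
  complex.Re (inner H (x v) v) <= K * nsq v.
Proof.
move=> K0 /(_ v) hK; apply: ler_of_sqr; first by rewrite mulr_ge0 ?nsq_ge0.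
apply: (@le_trans _ _ (nsq (x v) * nsq v)).
  apply: le_trans (form_CS inner_psd _ _).
  by rewrite /sqn lerDl sqr_ge0.
by rewrite exprMn expr2 (expr2 (nsq v)) mulrA ler_wpM2r ?nsq_ge0.
Qed.

Lemma positive_bound x (K : R) : 0 <= K -> positive_operator x ->
  (forall v, nsq (x v) <= K ^+ 2 * nsq v) ->
  positive_operator (K%:C *: vone - x).
Proof.
move=> K0 x0 hK v; rewrite !vE innerDl innerNl innerZl.
rewrite (ge0_complexE (x0 v)) (qfE inner_psd) -rmorphM -rmorphB lecR subr_ge0.
exact: bounded_inner_le.
Qed.

(** Positivity makes [inner H (x u) v] a positive semidefinite form, hence a Hermitian one. *)
Lemma positive_adj x : positive_operator x -> vadj x = x.
Proof.
move=> x0; apply: vadj_uniq.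
have qP : psd_form (fun u v => inner H (x u) v).
  split=> // [w a u v|u a v w]; first by rewrite vlin !innerE.
  by rewrite !innerE.
by move=> v w; rewrite (form_herm qP) -innerC.
Qed.

Lemma positive_form x : positive_operator x ->
  psd_form (fun u v => inner H (x u) v).
Proof.
move=> x0; split=> // [w a u v|u a v w]; first by rewrite vlin !innerE.
by rewrite !innerE.
Qed.

(* For [0 <= x <= 1], [|xv|^4 <= <xv,v><x(xv),xv> <= |v|^2 |xv|^2]. *)
Lemma positive_le1_contract x : positive_operator x ->
  positive_operator (vone - x) -> forall v, nsq (x v) <= nsq v.
Proof.
move=> x0 x1 v; have := form_CS (positive_form x0) v (x v).
have le1 u : qf (fun u v => inner H (x u) v) u <= nsq u.
  have := ge0_Re (x1 u); rewrite !vE !innerE !cE subr_ge0; exact.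
have := le1 v; have := le1 (x v).
have := qf_ge0 (positive_form x0) v; have := qf_ge0 (positive_form x0) (x v).
rewrite (qfE inner_psd) -/(nsq _) /sqn !cE expr0n addr0.
have := nsq_ge0 (x v); have := nsq_ge0 v.
move: (nsq v) (nsq (x v)) (qf _ v) (qf _ (x v)) => a b c d.
move=> a0 b0 d0 c0 db ca bb; rewrite leNgt; apply/negP => ab.
have : c * d <= a * b by rewrite ler_pM.
nra.
Qed.
End Algebra.

Section Functionals.
Context {R : realType} {H : hilbertSpace R} {M : vonNeumannAlgebra H}.
Implicit Types (x y z : M) (f : M -> R[i]).

Definition pos_fun f := forall x, positive_operator x -> 0 <= f x.

Section Linear.
Variable f : M -> R[i].
Hypothesis fL : scalar f.

Lemma funD x y : f (x + y) = f x + f y.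
Proof. by rewrite -[x in LHS]scale1r fL mul1r. Qed.
Lemma fun0 : f 0 = 0.
Proof. by apply: (addrI (f 0)); rewrite -funD !addr0. Qed.
Lemma funZ a x : f (a *: x) = a * f x.
Proof. by rewrite -[a *: x in LHS]addr0 fL fun0 addr0. Qed.
Lemma funN x : f (- x) = - f x.
Proof. by rewrite -scaleN1r funZ mulN1r. Qed.
Lemma fun_sum I (r : seq I) (P : pred I) (F : I -> M) :
  f (\sum_(i <- r | P i) F i) = \sum_(i <- r | P i) f (F i).
Proof. exact: (big_morph f funD fun0). Qed.

Definition funE := (funD, fun0, funZ, funN).

Definition vsq x : M := vmul (vadj x) x.

Lemma ciJ : Num.conj (ci : R[i]) = - ci.
Proof. by apply: complexP; rewrite !cE ?oppr0. Qed.

(** Polarization against the unit expresses [x] by four positive elements. [itv_lim] uses it to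
    extend limits known on the positive cone to all of [M]. *)
Lemma fun_polar x : 4 * f x = f (vsq (x + vone M)) - f (vsq (x - vone M))
  + ci * f (vsq (x + ci *: vone M)) - ci * f (vsq (x - ci *: vone M)).
Proof.
rewrite /vsq !vadjE !vmul_lin !vmul1l !vmul1r !ciJ !funE.
have -> : 4 = (4 : R)%:C :> R[i] by rewrite rmorph_nat.
move: (f x) (f (vadj x)) (f (vmul (vadj x) x)) (f (vone M)) => a b c d.
by apply: complexP; rewrite !cE; ring.
Qed.

Hypothesis f0 : pos_fun f.

Definition gns x y := f (vmul (vadj y) x).

Lemma gns_psd : psd_form gns.
Proof.
split=> [y a x z|x a y z|x]; rewrite /gns.
- by rewrite !vmul_lin !funE.
- by rewrite !vadjE !vmul_lin !funE.
- exact/f0/positive_adjM.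
Qed.

Lemma fun_le x y : positive_operator (y - x) -> complex.Re (f x) <= complex.Re (f y).
Proof. by move=> /f0/ge0_Re; rewrite !funE !cE subr_ge0. Qed.

Lemma fun_CS x : sqn (f x) <= complex.Re (f (vone M)) * complex.Re (f (vsq x)).
Proof.
have := form_CS gns_psd x (vone M).
by rewrite /qf /gns !vadjE !vmul1l mulrC.
Qed.

(** By Cauchy-Schwarz in the GNS form |f(x)|^2 <= f(1) f(x^* x), and x^* x <= 1. This is how the
    norm of a positive functional is controlled by its value at 1. *)
Lemma fun_contract x : (forall v, nsq (x v) <= nsq v) ->
  sqn (f x) <= complex.Re (f (vone M)) ^+ 2.
Proof.
move=> hx; apply: le_trans (fun_CS x) _; rewrite expr2.
apply: ler_wpM2l; first exact/ge0_Re/f0/positive_one.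
apply: fun_le => v; rewrite !vE !innerE vadjP' !(qfE inner_psd) -rmorphB.
by rewrite lecR subr_ge0 hx.
Qed.
End Linear.
End Functionals.

(** * Positive functionals below a normal one are normal *)

Section L2.
Context {R : realType} {H : hilbertSpace R} {M : vonNeumannAlgebra H}.
Implicit Types (x y z : M) (u w : nat -> H).

Definition l2 u := exists B : R, forall N, \sum_(0 <= k < N) nsq (u k) <= B.

Definition psum x N u w : R[i] := \sum_(0 <= k < N) inner H (x (u k)) (w k).

Lemma psum_psd x N : positive_operator x -> psd_form (psum x N).
Proof.
move=> x0; split=> [w a u v|u a v w|u]; rewrite /psum.
- by rewrite mulr_sumr -big_split; apply: eq_bigr => k _; rewrite vlin !innerE.
- by rewrite mulr_sumr -big_split; apply: eq_bigr => k _; rewrite !innerE.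
- by apply: sumr_ge0 => k _; apply: x0.
Qed.

Lemma qf_psum1 N u : qf (psum (vone M) N) u = \sum_(0 <= k < N) nsq (u k).
Proof. by rewrite /qf /psum (big_morph _ ReD (erefl _)). Qed.

Lemma psum_mono u : {homo (fun N => \sum_(0 <= k < N) nsq (u k)) :
  m n / (m <= n)%N >-> m <= n}.
Proof.
move=> m n mn; rewrite [leRHS](big_cat_nat (n := m)) //= lerDl.
by apply: sumr_ge0 => k _; exact: nsq_ge0.
Qed.

Lemma l2_cvg u : l2 u -> cvgn (fun N => \sum_(0 <= k < N) nsq (u k)).
Proof.
move=> [B hB]; apply: nondecreasing_is_cvgn; first exact: psum_mono.
by exists B => _ [N _ <-].
Qed.

Lemma l2P u : l2 u <-> l2_seq u.
Proof.
have E : series (fun n => `|u n| ^+ 2 : R[i]^o) =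
    (fun N => (\sum_(0 <= k < N) nsq (u k))%:C).
  by apply/funext => N; rewrite rmorph_sum; apply: eq_bigr => k _; rewrite -nsqE.
rewrite /l2_seq /= E; split=> [/l2_cvg/cvg_ex[l hl]|/cvg_ex[l /cvgC_Re /= hl]].
  by apply/cvg_ex; exists l%:C; apply: cvgC_ReIm => //=; exact: cvg_cst.
exists (complex.Re l) => N; rewrite -(cvg_lim _ hl) //.
apply: nondecreasing_cvgn_le; first exact: psum_mono.
by apply/cvg_ex; exists (complex.Re l).
Qed.

Lemma l2D u w : l2 u -> l2 w -> l2 (u + w).
Proof.
move=> [B hB] [D hD]; exists (2 * (B + D)) => N.
rewrite -!qf_psum1; apply: le_trans (qfD_le (psum_psd N (@positive_one _ _ M)) _ _) _.
by rewrite ler_pM2l // lerD // qf_psum1.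
Qed.

Lemma l2_op x u : l2 u -> l2 (x \o u).
Proof.
move=> [B hB]; have [K K0 hK] := vbounded x; exists (K ^+ 2 * B) => N.
apply: (@le_trans _ _ (\sum_(0 <= k < N) K ^+ 2 * nsq (u k))).
  by apply: ler_sum => k _; exact: hK.
by rewrite -mulr_sumr ler_wpM2l ?sqr_ge0.
Qed.

Lemma l2Z (a : R[i]) u : l2 u -> l2 (a *: u).
Proof. exact: (@l2_op (a *: vone M)). Qed.

(** This is [l2_functional] on bare sequences, so that sums, differences and images of sequences can
    be inserted without membership proofs. *)
Definition ipl x u w : R[i] := limn (series (fun n => inner H (x (u n)) (w n) : R[i]^o)).

(** The operator is absorbed into [u]; polarization then writes each partial sum by four partial
    sums of squared norms, which are monotone and bounded. *)
Lemma psum_cvg x u w : l2 u -> l2 w ->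
  (fun N => psum x N u w : R[i]^o) @ \oo --> (ipl x u w : R[i]^o).
Proof.
move=> lu lw; suff : cvgn (fun N => psum x N u w : R[i]^o) by [].
have {lu} lxu := l2_op x lu.
have E N : psum x N u w = psum (vone M) N (x \o u) w by [].
under eq_fun do rewrite E; move: (x \o u) lxu => {E}{}u lu.
have P N := psum_psd N (@positive_one _ _ M).
have Q v : l2 v -> exists l : R, (fun N => qf (psum (vone M) N) v) @ \oo --> l.
  by move=> /l2_cvg/cvg_ex[l hl]; exists l; under eq_fun do rewrite qf_psum1.
have lZ a : l2 (a *: w) by exact: l2Z.
have [l1 h1] := Q _ (l2D lu lw).
have [l2' h2] := Q _ (l2D lu (lZ (-1))).
have [l3 h3] := Q _ (l2D lu (lZ ci)).
have [l4 h4] := Q _ (l2D lu (lZ (- ci))).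
apply/cvg_ex; exists (4^-1 * (l1%:C - l2'%:C + ci * l3%:C - ci * l4%:C)).
have PE N : psum (vone M) N u w = 4^-1 * ((qf (psum (vone M) N) (u + w))%:C
   - (qf (psum (vone M) N) (u + (-1) *: w))%:C
   + ci * (qf (psum (vone M) N) (u + ci *: w))%:C
   - ci * (qf (psum (vone M) N) (u + (- ci) *: w))%:C).
  by rewrite scaleN1r scaleNr -form_polar // mulKf // pnatr_eq0.
rewrite (funext PE).
have mC1 (g : nat -> R) (l : R) : g @ \oo --> l ->
    (fun N => (g N)%:C : R[i]^o) @ \oo --> (l%:C : R[i]^o) by exact: toC_cvg.
have mC (c : R[i]) (g : nat -> R) (l : R) : g @ \oo --> l ->
    (fun N => c * (g N)%:C : R[i]^o) @ \oo --> (c * l%:C : R[i]^o).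
  by move=> gl; apply: cvgMl_tmp; exact: toC_cvg.
apply: cvgMl_tmp.
exact: (cvgB (cvgD (cvgB (mC1 _ _ h1) (mC1 _ _ h2)) (mC ci _ _ h3)) (mC ci _ _ h4)).
Qed.
End L2.
Arguments psum_cvg {R H M} x {u w}.

Lemma psd_lim {R : realType} {V : lmodType R[i]} (qN : nat -> V -> V -> R[i])
    (q : V -> V -> R[i]) :
  (forall N, psd_form (qN N)) ->
  (forall u v, (fun N => qN N u v : R[i]^o) @ \oo --> (q u v : R[i]^o)) -> psd_form q.
Proof.
move=> P h; split=> [w a u v|u a v w|u].
- apply: (cvg_unique (T := R[i]^o) _ (h (a *: u + v) w)) => //.
  rewrite (_ : (fun N => _) = (fun N => a * qN N u w + qN N v w)).
    by apply: cvgD => //; exact: cvgMl_tmp.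
  by apply/funext => N; have [-> _ _] := P N.
- apply: (cvg_unique (T := R[i]^o) _ (h u (a *: v + w))) => //.
  rewrite (_ : (fun N => _) = (fun N => Num.conj a * qN N u v + qN N u w)).
    by apply: cvgD => //; exact: cvgMl_tmp.
  by apply/funext => N; have [_ -> _] := P N.
- rewrite lecE; apply/andP; split.
    apply/eqP; apply: (cvg_unique (T := R) _ (cvgC_Im (h u u))) => //.
    rewrite (_ : (fun N => _) = (fun=> 0)); first exact: cvg_cst.
    by apply/funext => N; rewrite (qfE (P N)).
  apply: (cvgr_to_ge (cvgC_Re (h u u))); near=> N; exact: (qf_ge0 (P N)).
Unshelve. all: by end_near. Qed.

Lemma psd_sum {R : realType} {V : lmodType R[i]} I (r : seq I)
    (q : I -> V -> V -> R[i]) : (forall i, psd_form (q i)) ->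
  psd_form (fun u v => \sum_(i <- r) q i u v).
Proof.
move=> P; split=> [w a u v|u a v w|u].
- by rewrite mulr_sumr -big_split; apply: eq_bigr => i _; have [-> _ _] := P i.
- by rewrite mulr_sumr -big_split; apply: eq_bigr => i _; have [_ -> _] := P i.
- by apply: sumr_ge0 => i _; have [_ _ ->] := P i.
Qed.

Section L2limits.
Context {R : realType} {H : hilbertSpace R} {M : vonNeumannAlgebra H}.
Implicit Types (x y z : M) (u w : nat -> H).

Lemma iplE x y u w :
  ipl (vone M) (x \o u) (y \o w) = ipl (vmul (vadj y) x) u w.
Proof.
rewrite /ipl (_ : (fun n => _) = (fun n => inner H (vmul (vadj y) x (u n)) (w n))) //.
by apply/funext => n; rewrite /= vadjP'.
Qed.

Lemma ipl_psd (zeta : nat -> H) : l2 zeta ->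
  psd_form (fun x y => ipl (vone M) (x \o zeta) (y \o zeta)).
Proof.
move=> lz; apply: (psd_lim (qN := fun N x y => psum (vone M) N (x \o zeta) (y \o zeta))).
  move=> N; have [h1 h2 h3] := psum_psd N (@positive_one _ _ M).
  split=> [y a x z|x a y z|x]; last exact: h3.
    exact: (h1 (y \o zeta) a (x \o zeta) (z \o zeta)).
  exact: (h2 (x \o zeta) a (y \o zeta) (z \o zeta)).
by move=> x y; apply: psum_cvg; exact: l2_op.
Qed.

Lemma sqn_cvg (f : nat -> R[i]) (l : R[i]) :
  (f : nat -> R[i]^o) @ \oo --> (l : R[i]^o) -> (fun n => sqn (f n)) @ \oo --> sqn l.
Proof.
move=> h; rewrite /sqn.
rewrite (_ : (fun n => _) = ((fun n => complex.Re (f n)) \* (fun n => complex.Re (f n))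
  + (fun n => complex.Im (f n)) \* (fun n => complex.Im (f n)))).
  apply: cvgD; rewrite expr2; apply: cvgM.
  - exact: cvgC_Re. - exact: cvgC_Re. - exact: cvgC_Im. - exact: cvgC_Im.
by apply/funext => n; rewrite !expr2.
Qed.

Lemma ipl_CS x u w : positive_operator x -> l2 u -> l2 w ->
  sqn (ipl x u w) <= complex.Re (ipl x u u) * complex.Re (ipl x w w).
Proof.
move=> x0 lu lw.
have h1 := sqn_cvg (psum_cvg x lu lw).
have h2 : (fun N => complex.Re (psum x N u u) * complex.Re (psum x N w w)) @ \oo -->
    complex.Re (ipl x u u) * complex.Re (ipl x w w).
  by apply: cvgM; apply: cvgC_Re; exact: psum_cvg.
apply: (ler_cvg_to h1 h2).
by near=> N; apply: form_CS (psum_psd N x0) _ _.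
Unshelve. all: by end_near. Qed.

Lemma ipl_ge0 x u : positive_operator x -> l2 u -> 0 <= complex.Re (ipl x u u).
Proof.
move=> x0 lu; apply: (cvgr_to_ge (cvgC_Re (psum_cvg x lu lu))).
by near=> N; apply: (qf_ge0 (psum_psd N x0)).
Unshelve. all: by end_near. Qed.

Lemma ipl1_le (B : R) u : l2 u -> (forall N, \sum_(0 <= k < N) nsq (u k) <= B) ->
  complex.Re (ipl (vone M) u u) <= B.
Proof.
move=> lu hB; apply: (cvgr_to_le (cvgC_Re (psum_cvg (vone M) lu lu))).
by near=> N; rewrite -[complex.Re _]/(qf (psum _ N) u) qf_psum1.
Unshelve. all: by end_near. Qed.

Lemma ipl1_ge u N : l2 u ->
  \sum_(0 <= k < N) nsq (u k) <= complex.Re (ipl (vone M) u u).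
Proof.
move=> lu; apply: (cvgr_to_ge (cvgC_Re (psum_cvg (vone M) lu lu))).
near=> m; rewrite -[complex.Re _]/(qf (psum _ m) u) qf_psum1; apply: psum_mono.
by near: m; exact: nbhs_infty_ge.
Unshelve. all: by end_near. Qed.

Lemma iplDr x u w w' : l2 u -> l2 w -> l2 w' ->
  ipl x u (w - w') = ipl x u w - ipl x u w'.
Proof.
move=> lu lw lw'.
have lww : l2 (w - w').
  by rewrite -scaleN1r; apply: (@l2D _ _ M) => //; exact: (@l2Z _ _ M).
apply: (cvg_unique (T := R[i]^o) _ (psum_cvg x lu lww)) => //.
rewrite (_ : (fun N => _) = (fun N => psum x N u w) \- (fun N => psum x N u w')).
  by apply: cvgB; exact: psum_cvg.
apply/funext => N; rewrite /psum /= -sumrB; apply: eq_bigr => k _.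
by rewrite -innerNr -innerDr.
Qed.

Lemma nsq_cvg {T} {F : set_system T} {FF : Filter F} (u : T -> H) l :
  u @ F --> l -> (fun i => nsq (u i)) @ F --> nsq l.
Proof.
move=> ul.
have E i : nsq (u i) = nsq (u i - l) + (2 * complex.Re (inner H (u i) l) - nsq l).
  by rewrite /nsq (qfB inner_psd); ring.
rewrite (funext E).
rewrite [X in _ --> X](_ : nsq l = 0 + (2 * complex.Re (inner H l l) - nsq l)).
  2: by rewrite /nsq /qf; ring.
apply: cvgD; first exact/cvgH_nsq.
apply: cvgB; last exact: cvg_cst.
apply: cvgMl_tmp; apply: cvgC_Re; exact: inner_cvg.
Qed.

(** Completeness of the space of square-summable sequences, with the rate kept: the limit is taken
    in each component, then the index [j] goes to infinity inside finite partial sums. *)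
Lemma l2_complete (u : nat -> nat -> H) (d : nat -> R) :
  d @ \oo --> (0 : R) -> (forall k, l2 (u k)) ->
  (forall j k N, \sum_(0 <= n < N) nsq (u j n - u k n) <= d j + d k) ->
  exists2 eta, l2 eta & forall k N, \sum_(0 <= n < N) nsq (u k n - eta n) <= d k.
Proof.
move=> d0 lu hd.
have cu n : cvgn (fun k => u k n).
  apply: cauchyH => e e0; have e2 : 0 < e / 2 by rewrite divr_gt0.
  have [N _ hN] := cvgr_lt _ d0 _ e2.
  exists N => j k Nj Nk.
  have := hd j k n.+1; rewrite big_nat_recr //= => h.
  rewrite [e]splitr; apply: le_lt_trans (ltrD (hN _ Nj) (hN _ Nk)).
  by apply: le_trans h; rewrite lerDr sumr_ge0 // => i _; exact: nsq_ge0.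
pose eta n := limn (fun k => u k n).
have ueta n : (fun k => u k n) @ \oo --> eta n by exact: cu.
have key k N : \sum_(0 <= n < N) nsq (u k n - eta n) <= d k.
  have hs : (fun j => \sum_(0 <= n < N) nsq (u j n - u k n)) @ \oo -->
      \sum_(0 <= n < N) nsq (eta n - u k n).
    apply: cvg_big => [|n _]; first exact: add_continuous.
    by apply: nsq_cvg; apply: cvgB => //; exact: cvg_cst.
  have hdk : (fun j => d j + d k) @ \oo --> 0 + d k.
    by apply: cvgD => //; exact: cvg_cst.
  rewrite add0r in hdk.
  under eq_bigr => n _ do rewrite -opprB /nsq -scaleN1r (qfZ inner_psd) 
    /sqn !cE oppr0 expr0n addr0 sqrrN expr1n mul1r.
  apply: (ler_cvg_to hs hdk); near=> j; exact: hd.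
exists eta => //.
have -> : eta = u 0%N - (u 0%N - eta) by rewrite opprB addrC subrK.
rewrite -scaleN1r; apply: (@l2D _ _ M) => //; apply: (@l2Z _ _ M).
by exists (d 0%N); exact: key.
Unshelve. all: by end_near. Qed.
End L2limits.

Section Normal.
Context {R : realType} {H : hilbertSpace R} {M : vonNeumannAlgebra H}.
Implicit Types (x y z : M).

Notation L2 := (set_type (@l2_seq R H)).

Lemma l2_val (zeta : L2) : l2 (val zeta).
Proof. by apply/l2P; exact: set_mem (valP zeta). Qed.

Lemma l2_functionalE x (p : L2 * L2) :
  l2_functional x p = ipl x (val p.1) (val p.2).
Proof. by []. Qed.

Lemma l2_functional_lin (p : L2 * L2) : scalar (fun x => l2_functional x p).
Proof.
move=> a x y; rewrite !l2_functionalE.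
have h z := psum_cvg z (l2_val p.1) (l2_val p.2).
apply: (cvg_unique (T := R[i]^o) _ (h (a *: x + y))) => //.
rewrite (_ : (fun N => _) =
  (fun N => a * psum x N (val p.1) (val p.2) + psum y N (val p.1) (val p.2))).
  by apply: cvgD => //; exact: cvgMl_tmp.
apply/funext => N; rewrite /psum mulr_sumr -big_split; apply: eq_bigr => k _.
by rewrite !vE !innerE.
Qed.

Lemma cvg_sigma_weak (F : set_system M) (s : M) : Filter F ->
  (forall p : L2 * L2, (fun x => l2_functional x p : R[i]^o) @ F -->
     (l2_functional s p : R[i]^o)) ->
  F --> (s : sigma_weak M).
Proof.
move=> FF h A /= [_ [[C oC <-] Cs sCA]].
have : (@l2_functional R H M : M -> {ptws (L2 * L2)%type -> R[i]^o}) @ F -->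
      (l2_functional s : {ptws (L2 * L2)%type -> R[i]^o}).
  apply/cvg_sup => p U /= [_ [[D oD <-] Ds sDU]].
  apply: filterS sDU _; apply: (h p D); exact: open_nbhs_nbhs.
move=> /(_ C) FC; apply: filterS sCA _; apply: FC; exact: open_nbhs_nbhs.
Qed.

Lemma l2_functional_continuous (p : L2 * L2) :
  continuous ((fun x => l2_functional x p) : sigma_weak M -> R[i]^o).
Proof.
move=> s.
apply: (@continuous_comp _ _ _
  (@l2_functional R H M : sigma_weak M -> {ptws (L2 * L2)%type -> R[i]^o}) (proj p)).
  exact: initial_continuous.
exact: proj_continuous.
Qed.

(** Basic neighbourhoods of 0 in the sigma-weak topology. The filter they generate converges to 0,
    which turns continuity of a normal functional into the finite condition of [normal_bound]. *)
Definition sw_base (re : seq (L2 * L2) * R) : set M :=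
  [set x : M | \sum_(p <- re.1) sqn (l2_functional x p) < re.2].

Lemma sw_filter : Filter (filter_from [set re : seq (L2 * L2) * R | 0 < re.2] sw_base).
Proof.
apply: filter_from_filter; first by exists ([::], 1) => /=.
move=> [r e] [r' e'] /= e0 e0'; exists (r ++ r', Num.min e e') => /=.
  by rewrite lt_min e0.
have s0 (rr : seq (L2 * L2)) x : 0 <= \sum_(p <- rr) sqn (l2_functional x p).
  by apply: sumr_ge0 => p _; exact: sqn_ge0.
move=> x; rewrite /sw_base /= big_cat /= lt_min => /andP[h1 h2].
split; [apply: le_lt_trans h1|apply: le_lt_trans h2].
  by rewrite lerDl.
by rewrite lerDr.
Qed.

Lemma normal_bound (phi : predual M) :
  exists (r : seq (L2 * L2)) (e : R), 0 < e /\
    forall x, \sum_(p <- r) sqn (l2_functional x p) < e -> sqn (phi x) < 1.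
Proof.
have [lphi cphi] := set_mem (predual_normal phi).
have FF := sw_filter.
have F0 : filter_from [set re : seq (L2 * L2) * R | 0 < re.2] sw_base -->
    ((0 : M) : sigma_weak M).
  apply: cvg_sigma_weak => p; apply/cvgC_sqn.
  apply/cvgrPdistC_lt => e e0; exists ([:: p], e) => //= x.
  rewrite /sw_base /= big_seq1 (fun0 (l2_functional_lin p)) !subr0.
  by rewrite ger0_norm ?sqn_ge0.
have : (phi : M -> R[i]^o) @ filter_from [set re : seq (L2 * L2) * R | 0 < re.2] sw_base
    --> (phi 0 : R[i]^o).
  by move=> A /(cphi 0); exact: F0.
rewrite (fun0 lphi) => /cvgC_sqn/cvgr_lt/(_ 1 ltr01) [[r e] /= e0 h].
by exists r, e; split=> // x hx; have := h x hx; rewrite /= subr0.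
Qed.

Lemma sum_sqr_le I (r : seq I) (a : I -> R) : (forall i, 0 <= a i) ->
  \sum_(i <- r) a i ^+ 2 <= (\sum_(i <- r) a i) ^+ 2.
Proof.
move=> a0; elim: r => [|i r ih]; first by rewrite !big_nil expr0n.
rewrite !big_cons.
have := a0 i; have : 0 <= \sum_(i <- r) a i by exact: sumr_ge0.
move: ih (a i) => /=; move: (\sum_(j <- r) a j) (\sum_(j <- r) a j ^+ 2) => s t.
by move=> st b s0 b0; nra.
Qed.

(** For positive [x], Cauchy-Schwarz bounds |<x xi, eta>| by the sum of <x xi, xi> and <x eta, eta>.
    Continuity at 0 thus becomes a bound on the set where these diagonal sums are small, and
    homogeneity in [x] makes it linear. *)
Lemma normal_dominated (phi : predual M) :
  exists (r : seq L2) (C : R), 0 <= C /\ forall x, positive_operator x ->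
    complex.Re (phi x) <= C * \sum_(z <- r) complex.Re (l2_functional x (z, z)).
Proof.
have [lphi cphi] := set_mem (predual_normal phi).
have [r [e [e0 h]]] := normal_bound phi.
exists (map fst r ++ map snd r), (2 / Num.sqrt e).
have se0 : 0 < Num.sqrt e by rewrite sqrtr_gt0.
split=> [|x x0]; first by rewrite divr_ge0 // ltW.
pose a (p : L2 * L2) := complex.Re (l2_functional x (p.1, p.1)) +
  complex.Re (l2_functional x (p.2, p.2)).
have pos (z : L2) : 0 <= complex.Re (l2_functional x (z, z)).
  by apply: ipl_ge0 x0 (l2_val z).
have a0 p : 0 <= a p by rewrite addr_ge0.
rewrite [X in _ * X](_ : _ = \sum_(p <- r) a p).
  2: by rewrite /a big_split big_cat !big_map.
set T := \sum_(p <- r) a p.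
have T0 : 0 <= T by exact: sumr_ge0.
have bnd : \sum_(p <- r) sqn (l2_functional x p) <= T ^+ 2.
  apply: le_trans (sum_sqr_le r a0); apply: ler_sum => p _.
  apply: le_trans (ipl_CS x0 (l2_val p.1) (l2_val p.2)) _.
  have := pos p.1; have := pos p.2; rewrite /a !l2_functionalE /=.
  by move: (complex.Re _) (complex.Re _) => b c; nra.
have scale (s : R) : s ^+ 2 * T ^+ 2 < e -> s * complex.Re (phi x) < 1.
  move=> hs; have : sqn (phi (s%:C *: x)) < 1.
    apply: h; apply: le_lt_trans hs.
    apply: le_trans (ler_wpM2l (sqr_ge0 s) bnd).
    rewrite mulr_sumr; apply: ler_sum => p _.
    by rewrite (funZ (l2_functional_lin p)) sqnM /sqn /= expr0n addr0.
  rewrite (funZ lphi) sqnM {1}/sqn /= expr0n addr0 /sqn => h1.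
  rewrite ltNge; apply/negP => h2.
  have : (s * complex.Re (phi x)) ^+ 2 < 1.
    by apply: le_lt_trans h1; rewrite exprMn ler_wpM2l ?sqr_ge0 // lerDl sqr_ge0.
  by nra.
have [T_gt0|T_le0] := ltP 0 T.
  (* The factor puts the rescaled sum of squares at e/4 at most, inside the neighbourhood; solving
     for [phi x] gives the constant 2 / sqrt e. *)
  have := scale (Num.sqrt e / (2 * T)).
  have -> : (Num.sqrt e / (2 * T)) ^+ 2 * T ^+ 2 = e / 4.
    rewrite -[in RHS](sqr_sqrtr (ltW e0)); field; exact: lt0r_neq0.
  have -> : e / 4 < e by lra.
  move=> /(_ isT); rewrite mulrAC ltr_pdivrMr ?mulr_gt0 // mul1r => h1.
  by rewrite mulrAC ler_pdivlMr // mulrC ltW.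
have TE : T = 0 by apply/le_anti/andP.
rewrite TE mulr0 leNgt; apply/negP => p0.
(* If the diagonal sums vanish, every rescaling stays in the neighbourhood, so a positive value
   could be scaled up to 2, against the bound 1. *)
have := scale (2 / complex.Re (phi x)).
rewrite TE expr0n mulr0 e0 => /(_ isT); rewrite divfK ?gt_eqF //.
by lra.
Qed.
End Normal.

Section Dominated.
Context {R : realType} {H : hilbertSpace R} {M : vonNeumannAlgebra H}.
Implicit Types (x y z : M).
Notation L2 := (set_type (@l2_seq R H)).

Lemma cvg_2harmonic : (fun k => 2 * k.+1%:R^-1 : R) @ \oo --> (0 : R).
Proof.
rewrite -[X in _ --> X](mulr0 2); apply: cvgMl_tmp.
exact: (@cvg_harmonic R).
Qed.

(** The role of the GNS vector is played by the finite family [zeta] of square-summable sequences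
    that dominates [phi]. The form [q] need not be complete, so Riesz only yields approximants [a k]
    in [M]. Their images of each [zeta i] are Cauchy, and the limits [eta i] exhibit [h] as a finite
    sum of sigma-weakly continuous functionals. *)
Lemma dominated_normal (phi : predual M) (h : M -> R[i]) :
  scalar h -> pos_fun h ->
  (forall x, positive_operator x -> complex.Re (h x) <= complex.Re (phi x)) ->
  h \in @normal_functional R H M.
Proof.
move=> hL h0 hphi; have [r [C [C0 hC]]] := normal_dominated phi.
pose m := size r; pose zeta (i : 'I_m) : L2 := tnth (in_tuple r) i.
have lz i : l2 (val (zeta i)) := l2_val (zeta i).
pose q x y := \sum_(i <- enum 'I_m) ipl (vone M) (x \o val (zeta i)) (y \o val (zeta i)).
have qP : psd_form q by apply: psd_sum => i; exact: ipl_psd.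
have qfqE x : qf q x = \sum_(i < m)
    complex.Re (ipl (vone M) (x \o val (zeta i)) (x \o val (zeta i))).
  by rewrite /qf /q big_enum (big_morph _ ReD (erefl _)).
have h1_ge0 : 0 <= complex.Re (h (vone M)) by exact/ge0_Re/h0/positive_one.
have h_bnd x : sqn (h x) <= complex.Re (h (vone M)) * C * qf q x.
  apply: le_trans (fun_CS hL h0 x) _; rewrite -mulrA ler_wpM2l //.
  apply: le_trans (hphi _ (positive_adjM x)) _.
  apply: le_trans (hC _ (positive_adjM x)) _; rewrite ler_wpM2l //.
  rewrite qfqE big_tnth; apply: ler_sum => i _.
  by rewrite iplE l2_functionalE.
have [a [a_cauchy a_lim]] := form_riesz qP hL (mulr_ge0 h1_ge0 C0) h_bnd.
pose d k : R := 2 * k.+1%:R^-1.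
have ex_eta i : exists e : L2, forall k N,
    \sum_(0 <= n < N) nsq ((a k) (val (zeta i) n) - val e n) <= d k.
  have [||j k N|eta leta heta] := @l2_complete _ _ M
    (fun k => a k \o val (zeta i)) d.
  - exact: cvg_2harmonic.
  - by move=> k; exact: l2_op.
  - rewrite /d -mulrDr; apply: le_trans (a_cauchy j k).
    rewrite qfqE (bigD1 i) //= -[leLHS]addr0 lerD //.
      apply: (@ipl1_ge _ _ M ((a j - a k) \o val (zeta i)) N).
      exact: l2_op.
    apply: sumr_ge0 => i' _; apply: ipl_ge0; first exact: positive_one.
    exact: (l2_op (a j - a k) (lz i')).
  - have leta' : eta \in @l2_seq R H by apply: mem_set; apply/l2P.
    by exists (exist _ eta leta').
have [eta etaP] := choice ex_eta.
have hE x : h x = \sum_(i <- enum 'I_m) l2_functional x (zeta i, eta i).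
  (* Both sides are limits of [q x (a k)]: one by the Riesz estimate, the other because
     [a k \o zeta i] tends to [eta i]. *)
  apply: (@cvg_unique R[i]^o _ ((fun k => q x (a k) : R[i]^o) @ \oo)) => //.
    apply/cvgC_sqn.
    have hb : (fun k => k.+1%:R^-1 * qf q x) @ \oo --> (0 : R).
      rewrite -[X in _ --> X](mul0r (qf q x)); apply: cvgMr_tmp.
      exact: (@cvg_harmonic R).
    apply: squeeze_cvgr (@cvg_cst _ _ _ _ _) hb; near=> k.
    rewrite sqn_ge0 /=; apply: le_trans (a_lim k x).
    by rewrite /sqn !cE -(sqrrN (_ - complex.Re (h x)))
       -(sqrrN (_ - complex.Im (h x))) !opprB.
  apply: cvg_big => [|i _]; first exact: add_continuous.
  have lx := l2_op x (lz i); have le := l2_val (eta i).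
  rewrite (_ : l2_functional x _ = ipl (vone M) (x \o val (zeta i)) (val (eta i))) //.
  apply/cvgC_sqn.
  set A := complex.Re (ipl (vone M) (x \o val (zeta i)) (x \o val (zeta i))).
  have hb : (fun k => A * d k) @ \oo --> (0 : R).
    by rewrite -[X in _ --> X](mulr0 A); apply: cvgMl_tmp; exact: cvg_2harmonic.
  apply: squeeze_cvgr (@cvg_cst _ _ _ _ _) hb; near=> k.
  rewrite sqn_ge0 /=; have lk := l2_op (a k) (lz i); rewrite -iplDr //.
  have lw : l2 (a k \o val (zeta i) - val (eta i)).
    by exists (d k) => N; exact: etaP.
  apply: le_trans (ipl_CS (@positive_one _ _ M) lx lw) _.
  rewrite ler_wpM2l //; first by apply: ipl_ge0 lx; exact: positive_one.
  by apply: ipl1_le lw _ => N; exact: etaP.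
apply: mem_set; split=> //.
rewrite (funext hE).
apply: (@continuous_big R[i]^o _ _ _ xpredT (@add_continuous R[i]^o) (sigma_weak M)).
by move=> i _; exact: l2_functional_continuous.
Unshelve. all: by end_near. Qed.
End Dominated.

(** * Order convergence implies norm convergence *)

Section Interval.
Context {R : realType} {H : hilbertSpace R} {M : vonNeumannAlgebra H}.
Variable phi : predual M.
Implicit Types (x y z : M) (psi chi : order_interval phi).

Lemma predual_scalar (chi : predual M) : scalar chi.
Proof. by have [] := set_mem (predual_normal chi). Qed.

Lemma itv_scalar psi : scalar psi.
Proof. exact: predual_scalar. Qed.

Lemma itv_pos psi : pos_fun psi.
Proof. by have [] := set_mem (interval_in psi). Qed.

Lemma itv_leP psi chi : (psi <= chi)%O <->
  forall x, positive_operator x -> complex.Re (psi x) <= complex.Re (chi x).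
Proof.
split=> [/asboolP h x x0|h]; first by have := h x x0; rewrite lecE => /andP[].
apply/asboolP => x x0.
by rewrite (ge0_complexE (itv_pos psi x0)) (ge0_complexE (itv_pos chi x0)) lecR h.
Qed.

Lemma itv_le_phi psi x : positive_operator x ->
  complex.Re (psi x) <= complex.Re (phi x).
Proof.
move=> x0; have [_ /asboolP h] := set_mem (interval_in psi).
by have := h x x0; rewrite lecE => /andP[].
Qed.

Lemma itv_ext psi chi : (forall x, psi x = chi x) -> psi = chi.
Proof. by move=> h; apply/val_inj/val_inj/funext. Qed.

Lemma itv_ex (h : M -> R[i]) : scalar h -> pos_fun h ->
  (forall x, positive_operator x -> h x <= phi x) ->
  exists psi : order_interval phi, forall x, psi x = h x.
Proof.
move=> hL h0 hphi.
have hn : h \in @normal_functional R H M.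
  apply: (dominated_normal (phi := phi)) hL h0 _ => x x0.
  by have := hphi x x0; rewrite lecE => /andP[].
have hin : Predual hn \in
    [set psi : predual M | positive_functional psi /\ (psi <= phi)%O].
  by apply: mem_set; split=> //; apply/asboolP.
by exists (OrderInterval hin).
Qed.

(** The polarization formula defines the candidate on all of [M]. Linearity and the bounds 0 and
    [phi] pass to the limit, and domination by [phi] supplies normality. *)
Lemma itv_lim T (F : set_system T) (FF : ProperFilter F) (f : T -> order_interval phi)
    (l : M -> R) :
  (forall x, positive_operator x -> (fun i => complex.Re (f i x)) @ F --> l x) ->
  exists L : order_interval phi, forall x, positive_operator x -> complex.Re (L x) = l x.
Proof.
move=> fl.
pose L x : R[i] := 4^-1 * ((l (vsq (x + vone M)))%:C - (l (vsq (x - vone M)))%:C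
  + ci * (l (vsq (x + ci *: vone M)))%:C - ci * (l (vsq (x - ci *: vone M)))%:C).
have fL x : (fun i => f i x : R[i]^o) @ F --> (L x : R[i]^o).
  have fE i : f i x = 4^-1 * ((complex.Re (f i (vsq (x + vone M))))%:C
      - (complex.Re (f i (vsq (x - vone M))))%:C
      + ci * (complex.Re (f i (vsq (x + ci *: vone M))))%:C
      - ci * (complex.Re (f i (vsq (x - ci *: vone M))))%:C).
    rewrite -!ge0_complexE; try exact/itv_pos/positive_adjM.
    by rewrite -(fun_polar (@itv_scalar _)) mulKf // pnatr_eq0.
  rewrite (funext fE); apply: cvgMl_tmp.
  have h y : (fun i => (complex.Re (f i (vsq y)))%:C : R[i]^o) @ F -->
      ((l (vsq y))%:C : R[i]^o) by exact/toC_cvg/fl/positive_adjM.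
  have h' (c : R[i]) y : (fun i => c * (complex.Re (f i (vsq y)))%:C : R[i]^o) @ F -->
      (c * (l (vsq y))%:C : R[i]^o) by apply: cvgMl_tmp; exact: h.
  exact: (cvgB (cvgD (cvgB (h _) (h _)) (h' _ _)) (h' _ _)).
have Lpos x : positive_operator x -> L x = (l x)%:C.
  move=> x0; apply: complexP => /=.
    by apply: (cvg_unique (T := R) _ (cvgC_Re (fL x)) (fl x x0)).
  apply: (cvg_unique (T := R) _ (cvgC_Im (fL x))) => //.
  rewrite (_ : (fun i => _) = (fun=> 0)); first exact: cvg_cst.
  by apply/funext => i; rewrite ge0_Im //; exact: itv_pos.
have [||x x0|psi psiE] := @itv_ex L.
- move=> a x y.
  apply: (cvg_unique (T := R[i]^o) _ (fL (a *: x + y))) => //.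
  rewrite (_ : (fun i => _) = (fun i => a * f i x + f i y)).
    have h1 : (fun i => a * f i x : R[i]^o) @ F --> (a * L x : R[i]^o).
      by apply: cvgMl_tmp; exact: fL.
    exact: (cvgD h1 (fL y)).
  by apply/funext => i; exact: itv_scalar.
- move=> x x0; rewrite Lpos // lecR; apply: (cvgr_to_ge (fl x x0)); near=> i.
  exact/ge0_Re/itv_pos.
- rewrite Lpos // lecE /=; apply/andP; split.
    (* That [phi x] is real is read off from its comparison with one [f i x]. *)
    have [i _] := @filter_ex _ F FF setT filterT.
    have [_ /asboolP /(_ x x0)] := set_mem (interval_in (f i)).
    by rewrite lecE (ge0_Im (itv_pos (f i) x0)) => /andP[].
  by apply: (cvgr_to_le (fl x x0)); near=> i; exact: itv_le_phi.
by exists psi => x x0; rewrite psiE Lpos.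
Unshelve. all: by end_near. Qed.

(** The pointwise suprema form an element [L] of the interval which bounds the net, so the least
    upper bound [psi] lies below [L]. *)
Lemma itv_monotone d' (G : preorderType d') (y : G -> order_interval phi) psi :
  directed G -> increases_to y psi -> forall x, positive_operator x ->
  forall e : R, 0 < e -> exists g, complex.Re (psi x) - complex.Re (y g x) < e.
Proof.
move=> [[g0] Gdir] [yinc [yub ylub]].
(* The filter of tails of the directed set, along which a monotone bounded net converges to its
   supremum. *)
pose F : set_system G := filter_from setT (fun g => [set h | (g <= h)%O]).
have FF : ProperFilter F.
  apply: filter_from_proper; last by move=> g _; exists g => /=.
  apply: filter_from_filter; first by exists g0.
  move=> g h _ _; have [k [gk hk]] := Gdir g h; exists k => // m /= km.
  by split; apply: le_trans km.
pose S x := range (fun g => complex.Re (y g x)).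
have Ssup x : positive_operator x -> has_sup (S x).
  move=> x0; split; first by exists (complex.Re (y g0 x)), g0.
  by exists (complex.Re (phi x)) => _ [g _ <-]; exact: itv_le_phi.
have Sub x g : positive_operator x -> complex.Re (y g x) <= sup (S x).
  by move=> x0; apply: ub_le_sup; [have [] := Ssup x x0|exists g].
have [|L LE] := @itv_lim G F FF y (fun x => sup (S x)).
  move=> x x0; apply/cvgrPdist_lt => e e0.
  have [_ [g _ <-] hg] := sup_adherent e0 (Ssup x x0).
  exists g => // h /= /yinc/itv_leP/(_ x x0) gh.
  by have hh := Sub x h x0; rewrite ger0_norm ?subr_ge0 //; lra.
have psiL : (psi <= L)%O.
  by apply: ylub => _ [g _ <-]; apply/itv_leP => x x0; rewrite LE // Sub.
move=> x x0 e e0; have [_ [g _ <-] hg] := sup_adherent e0 (Ssup x x0).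
exists g; move/itv_leP : psiL => /(_ x x0); rewrite LE //; lra.
Qed.

Lemma itv_compl_ex psi : exists chi : order_interval phi, forall x, chi x = phi x - psi x.
Proof.
apply: itv_ex => [a x y|x x0|x x0].
- by rewrite (predual_scalar phi) (itv_scalar psi) mulrBr opprD addrACA.
- by have [_ /asboolP] := set_mem (interval_in psi); move=> /(_ x x0); rewrite subr_ge0.
- by rewrite gerBl; exact: itv_pos.
Qed.

Definition itv_compl psi : order_interval phi := projT1 (cid (itv_compl_ex psi)).

Lemma itv_complE psi x : itv_compl psi x = phi x - psi x.
Proof. by rewrite /itv_compl; case: cid. Qed.

Lemma itv_complK psi : itv_compl (itv_compl psi) = psi.
Proof. by apply: itv_ext => x; rewrite !itv_complE subKr. Qed.

Lemma itv_compl_le psi chi : (psi <= chi)%O -> (itv_compl chi <= itv_compl psi)%O.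
Proof.
move=> /itv_leP h; apply/itv_leP => x x0.
by have := h x x0; rewrite !itv_complE !cE; lra.
Qed.

Lemma decreases_compl d' (G : preorderType d') (z : G -> order_interval phi) psi :
  decreases_to z psi -> increases_to (itv_compl \o z) (itv_compl psi).
Proof.
move=> [zdec [zlb zglb]]; split=> [a b ab|]; first exact/itv_compl_le/zdec.
split=> [_ [g _ <-]|w hw]; first by apply/itv_compl_le/zlb; exists g.
rewrite -[w]itv_complK; apply/itv_compl_le/zglb => _ [g _ <-].
rewrite -[z g]itv_complK; apply/itv_compl_le/hw; by exists g.
Qed.

Lemma functional_norm_le (f : M -> R[i]) (c : R) : 0 <= c ->
  (forall x, (forall v, nsq (x v) <= nsq v) -> sqn (f x) <= c ^+ 2) ->
  (functional_norm f <= c%:E)%E.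
Proof.
move=> c0 h; apply: ub_ereal_sup => _ [x hx <-].
rewrite lee_fin normC_sqn /= -(ger0_norm c0) -sqrtr_sqr ler_sqrt ?sqr_ge0 //.
by apply: h => v; rewrite -norm_le_nsq.
Qed.

Lemma functional_norm_ge (f : M -> R[i]) (c : R) x :
  (functional_norm f < c%:E)%E -> (forall v, nsq (x v) <= nsq v) ->
  sqn (f x) < c ^+ 2.
Proof.
move=> hf hx; have : ((complex.Re `|f x|)%:E < c%:E)%E.
  apply: le_lt_trans hf; apply: ereal_sup_ubound; exists x => // v.
  by rewrite /= norm_le_nsq.
rewrite lte_fin normC_sqn /= => h.
have c0 : 0 <= c by apply: le_trans (ltW h); exact: sqrtr_ge0.
by rewrite -(sqr_sqrtr (sqn_ge0 (f x))) ltr_sqr ?nnegrE ?sqrtr_ge0.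
Qed.

(** The triangle inequality for moduli in squared form; the cross term is bounded by Cauchy-Schwarz
    in the plane. *)
Lemma sqn_sub_le (a b : R[i]) (s t : R) : 0 <= s -> 0 <= t ->
  sqn a <= s ^+ 2 -> sqn b <= t ^+ 2 -> sqn (a - b) <= (s + t) ^+ 2.
Proof.
move=> s0 t0 ha hb.
have : - (complex.Re a * complex.Re b + complex.Im a * complex.Im b) <= s * t.
  apply: ler_of_sqr; first exact: mulr_ge0.
  rewrite exprMn; apply: le_trans (ler_pM (sqn_ge0 a) (sqn_ge0 b) ha hb).
  rewrite /sqn; have := sqr_ge0 (complex.Re a * complex.Im b - complex.Im a * complex.Re b).
  lra.
by move: ha hb; rewrite /sqn !cE; lra.
Qed.

(** A single close index is produced, which is what closedness arguments consume. Both [u g] and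
    [psi] dominate [y g], so their difference splits into two positive functionals whose norms are
    read at 1. *)
Lemma order_converges_norm d' (G : preorderType d') (u : G -> order_interval phi) psi :
  directed G -> order_converges u psi -> forall e : R, 0 < e ->
  exists g, (functional_norm (fun x : M => u g x - psi x)%R < e%:E)%E.
Proof.
move=> Gdir [y [z [yuz ypsi zpsi]]] e e0.
have e4 : 0 < e / 4 by rewrite divr_gt0.
have one0 := @positive_one _ _ M.
have [g1 hg1] := itv_monotone Gdir ypsi one0 e4.
have [g2 hg2] := itv_monotone Gdir (decreases_compl zpsi) one0 e4.
have [_ /(_ g1 g2) [g [gg1 gg2]]] := Gdir.
exists g.
have [yinc _] := ypsi; have [zdec _] := zpsi.
have [/itv_leP yu /itv_leP uz] := yuz g.
have hy := (itv_leP _ _).1 (yinc _ _ gg1) _ one0.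
have hz := (itv_leP _ _).1 (zdec _ _ gg2) _ one0.
have hyp : forall x, positive_operator x -> complex.Re (y g x) <= complex.Re (psi x).
  by apply/itv_leP; have [_ [+ _]] := ypsi; apply; exists g.
(* At 1, [u g - y g] is at most [z g - y g], which is below 2e/4, and [psi - y g] is below e/4. *)
apply: (@le_lt_trans _ _ (3 * (e / 4))%:E); last by rewrite lte_fin; lra.
apply: functional_norm_le => [|x hx]; first by lra.
have bound (chi : order_interval phi) :
    (forall x, positive_operator x -> complex.Re (y g x) <= complex.Re (chi x)) ->
    sqn (chi x - y g x) <= (complex.Re (chi (vone M)) - complex.Re (y g (vone M))) ^+ 2.
  move=> hchi; have := @fun_contract _ _ M (fun x => chi x - y g x) _ _ x hx.
  rewrite /= !cE; apply.
    by move=> a b c; rewrite !itv_scalar mulrBr opprD addrACA.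
  move=> b b0; rewrite (ge0_complexE (itv_pos chi b0)) (ge0_complexE (itv_pos (y g) b0)).
  by rewrite -rmorphB lecR subr_ge0 hchi.
have -> : u g x - psi x = (u g x - y g x) - (psi x - y g x) by rewrite opprB addrA subrK.
have hu1 := yu _ one0; have hu2 := uz _ one0; have hp := hyp _ one0.
move: hg2; rewrite /= !itv_complE !cE => hg2.
apply: le_trans (sqn_sub_le _ _ (bound _ yu) (bound _ hyp)) _; try lra.
by rewrite ler_pXn2r ?nnegrE //; lra.
Qed.

Lemma norm_opens_order U : norm_opens phi U -> order_opens (order_interval phi) U.
Proof.
move=> oU d' G u psi Gdir uU upsi Upsi; have [e e0 he] := oU psi Upsi.
by have [g /he] := order_converges_norm Gdir upsi e0; exact: uU.
Qed.
End Interval.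

(** * Nilpotent elements separate the two topologies *)

Section Vector.
Context {R : realType} {H : hilbertSpace R} {M : vonNeumannAlgebra H}.
Implicit Types (x y z : M) (u v w : H).

Definition vecfun u x : R[i] := inner H (x u) u.

Lemma vecfun_scalar u : scalar (vecfun u).
Proof. by move=> a x y; rewrite /vecfun !vE !innerE. Qed.

Lemma vecfun_pos u : pos_fun (vecfun u).
Proof. by move=> x x0; exact: x0. Qed.

Definition single u : nat -> H := fun n => if n is 0%N then u else 0.

Lemma single_l2 u : single u \in @l2_seq R H.
Proof.
apply/mem_set/l2P; exists (nsq u) => -[|N]; first by rewrite big_nil nsq_ge0.
by rewrite big_nat_recl //= big1 ?addr0 // => k _; rewrite nsq0.
Qed.

Definition single_elt u : set_type (@l2_seq R H) := exist _ (single u) (single_l2 u).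

Lemma vecfun_l2 u x : vecfun u x = l2_functional x (single_elt u, single_elt u).
Proof.
apply/esym; apply: (@cvg_lim R[i]^o) => //.
apply: cvg_near_cst; near=> N.
have -> : N = N.-1.+1 by rewrite prednK //; near: N; exact: nbhs_infty_gt.
rewrite /series /= big_nat_recl //= big1 ?addr0 // => k _.
by rewrite v0 inner0l.
Unshelve. all: by end_near. Qed.

Lemma vecfun_sum_normal (s : seq H) :
  (fun x => \sum_(u <- s) vecfun u x) \in @normal_functional R H M.
Proof.
apply: mem_set; split.
  move=> a x y; rewrite mulr_sumr -big_split; apply: eq_bigr => u _.
  exact: vecfun_scalar.
under eq_fun do under eq_bigr do rewrite vecfun_l2.
apply: (@continuous_big R[i]^o _ _ _ xpredT (@add_continuous R[i]^o) (sigma_weak M)).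
by move=> i _; exact: l2_functional_continuous.
Qed.

Lemma sqn_add_le (a b : R[i]) (s t : R) : 0 <= s -> 0 <= t ->
  sqn a <= s ^+ 2 -> sqn b <= t ^+ 2 -> sqn (a + b) <= (s + t) ^+ 2.
Proof.
move=> s0 t0 ha hb; rewrite -[b]opprK; apply: sqn_sub_le => //.
by rewrite /sqn !cE !sqrrN.
Qed.

Lemma sqn_inner_le x u v (s t : R) : (forall w, nsq (x w) <= nsq w) ->
  nsq u <= s ^+ 2 -> nsq v <= t ^+ 2 -> sqn (inner H (x u) v) <= (s * t) ^+ 2.
Proof.
move=> hx hu hv; apply: le_trans (form_CS inner_psd _ _) _.
by rewrite exprMn ler_pM ?(qf_ge0 inner_psd) //; apply: le_trans (hx u) hu.
Qed.

Lemma functional_norm_scale (f : M -> R[i]) (c K : R) x : scalar f -> 0 < K ->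
  (functional_norm f < c%:E)%E -> (forall v, nsq (x v) <= K ^+ 2 * nsq v) ->
  sqn (f x) <= (c * K) ^+ 2.
Proof.
move=> fL K0 hf hx.
have : sqn (f (K^-1%:C *: x)) < c ^+ 2.
  apply: functional_norm_ge hf _ => v.
  rewrite /nsq (qfZ inner_psd) /sqn /= expr0n addr0 exprVn.
  by rewrite ler_pdivrMl ?exprn_gt0 // hx.
rewrite (funZ fL) sqnM {1}/sqn /= expr0n addr0 exprVn.
by rewrite ltr_pdivrMl ?exprn_gt0 // exprMn [leRHS]mulrC => /ltW.
Qed.
End Vector.

Section Nilpotent.
Context {R : realType} {H : hilbertSpace R} {M : vonNeumannAlgebra H}.
Implicit Types (x y z : M) (u v w : H).

Lemma vadj_vmul_eq0 x v : vadj x (x v) = 0 -> x v = 0.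
Proof.
move=> h; apply: nsq_eq0.
by rewrite /nsq /qf vadjP h innerC inner0l rmorph0.
Qed.

(* If [y] lies below the vector functionals of [xi] and of [xi + t a xi], then in
   the GNS space of [y] both [a^*] and [a^* (1 - t a)] vanish, hence so does
   [a^* a]. *)
Lemma dominated_vec_eq0 (y : M -> R[i]) (a : M) (xi : H) (t : R) :
  scalar y -> pos_fun y -> vmul a a = 0 -> vadj a xi = 0 -> t != 0 ->
  (forall x, positive_operator x -> complex.Re (y x) <= complex.Re (vecfun xi x)) ->
  (forall x, positive_operator x ->
     complex.Re (y x) <= complex.Re (vecfun (xi + t%:C *: a xi) x)) ->
  complex.Re (y (vsq (vmul (vadj a) a))) = 0.
Proof.
move=> yL y0 aa axi t0 y1 y2; have qP := gns_psd yL y0.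
have vec0 x w : x w = 0 -> complex.Re (vecfun w (vsq x)) = 0.
  by move=> xw; rewrite /vecfun vE xw v0 inner0l.
have q0 x : complex.Re (y (vsq x)) <= 0 -> qf (gns y) x = 0.
  by move=> h; apply/le_anti/andP; split; [exact: h|exact: qf_ge0 qP x].
have c0 : qf (gns y) (vadj a) = 0.
  by apply: q0; apply: le_trans (y1 _ (positive_adjM _)) _; rewrite vec0.
(* In (a^* - t a^* a)(xi + t a xi) the terms of order t cancel, and the others vanish by a^* xi = 0
   and a a = 0. *)
have c'0 : qf (gns y) (vadj a - t%:C *: vmul (vadj a) a) = 0.
  apply: q0; apply: le_trans (y2 _ (positive_adjM _)) _; rewrite vec0 //.
  have aav w : a (a w) = 0 by rewrite -[LHS]/(vmul a a w) aa.
  by rewrite !vE !vopE axi aav !v0 !scaler0 !addr0 add0r subrr.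
(* The difference of the two null vectors is t a^* a, so this is null as well. *)
have := qfB_le qP (vadj a) (vadj a - t%:C *: vmul (vadj a) a).
rewrite c0 c'0 opprB addrC subrK (qfZ qP) addr0 mulr0.
rewrite sqn_real pmulr_rle0 ?exprn_even_gt0 // => h.
by apply/le_anti; rewrite h (qf_ge0 qP).
Qed.

(** Every a^* v lies in the kernel of a^*, as the adjoint also squares to 0. Were a^* a to vanish on
    that kernel, a^* a a^* v = 0 would give a a^* v = 0, then a^* v = 0 for all v. *)
Lemma nilpotent_vector (a : M) : a != 0 -> vmul a a = 0 ->
  exists2 xi : H, vadj a xi = 0 & vadj a (a xi) <> 0.
Proof.
move=> a0 aa; apply: contrapT => h; move/eqP: a0; apply.
rewrite -[a]vadjK; apply: vna_ext => w.
have aav v : a (a v) = 0 by rewrite -[LHS]/(vmul a a v) aa.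
have ha v : vadj a v = 0.
  have hb : vadj a (a (vadj a v)) = 0.
    apply: contrapT => h1; apply: h; exists (vadj a v) => //.
    apply: inner_inj => u; rewrite -!vadjP aav.
    by rewrite inner0l innerC inner0l rmorph0.
  by have := vadj_vmul_eq0 hb; rewrite -{1}[a]vadjK => /vadj_vmul_eq0.
rewrite vE; apply: inner_inj => u; rewrite -vadjP ha.
by rewrite inner0l innerC inner0l rmorph0.
Qed.

Lemma vecfun_line (xi w : H) (t : R) z : vecfun (xi + t%:C *: w) z =
  vecfun xi z + t%:C * (inner H (z w) xi + inner H (z xi) w) + (t ^+ 2)%:C * vecfun w z.
Proof.
rewrite /vecfun vD vZ !innerE.
by rewrite conj_real rmorphXn /=; ring.
Qed.

Lemma vecfun_line_cvg (xi w : H) (s : nat -> R) (t : R) z : s @ \oo --> t ->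
  (fun n => vecfun (xi + (s n)%:C *: w) z : R[i]^o) @ \oo -->
  (vecfun (xi + t%:C *: w) z : R[i]^o).
Proof.
move=> st; rewrite (funext (fun n => vecfun_line xi w (s n) z)) vecfun_line.
have h1 : (fun n => (s n)%:C : R[i]^o) @ \oo --> (t%:C : R[i]^o) by exact: toC_cvg.
have h2 : (fun n => (s n ^+ 2)%:C : R[i]^o) @ \oo --> ((t ^+ 2)%:C : R[i]^o).
  apply: toC_cvg; rewrite (_ : (fun n => _) = (fun n => s n * s n)).
    by rewrite expr2; exact: cvgM.
  by apply/funext => n; rewrite expr2.
have h3 c : (fun n => (s n)%:C * c : R[i]^o) @ \oo --> (t%:C * c : R[i]^o).
  by apply: cvgMr_tmp; exact: h1.
have h4 c : (fun n => (s n ^+ 2)%:C * c : R[i]^o) @ \oo --> ((t ^+ 2)%:C * c : R[i]^o).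
  by apply: cvgMr_tmp; exact: h2.
have h5 : (fun=> vecfun xi z : R[i]^o) @ \oo --> (vecfun xi z : R[i]^o).
  exact: cvg_cst.
exact: (cvgD (cvgD h5 (h3 _)) (h4 _)).
Qed.

Lemma functional_norm_line (xi w : H) (e : R) : 0 < e -> exists t : R, [/\ 0 < t, t <= 1 &
  (functional_norm (fun x : M => vecfun (xi + t%:C *: w) x - vecfun xi x)%R < e%:E)%E].
Proof.
move=> e0; pose s := Num.sqrt (nsq xi); pose r := Num.sqrt (nsq w).
have s0 : 0 <= s by exact: sqrtr_ge0.
have r0 : 0 <= r by exact: sqrtr_ge0.
have hs : nsq xi <= s ^+ 2 by rewrite sqr_sqrtr ?nsq_ge0.
have hr : nsq w <= r ^+ 2 by rewrite sqr_sqrtr ?nsq_ge0.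
(* The difference of functionals is [t] times <x w, xi> + <x xi, w> + t <x w, w>, which [B] bounds
   for contractions [x] and t <= 1. The [t] chosen next satisfies both t <= 1 and t B < e. *)
pose B := 2 * (r * s) + r ^+ 2.
have B0 : 0 <= B by rewrite addr_ge0 ?mulr_ge0 ?sqr_ge0.
pose t := e / (e + B + 1); have d0 : 0 < e + B + 1 by lra.
have t0 : 0 < t by rewrite divr_gt0.
have t1 : t <= 1 by rewrite ler_pdivrMr // mul1r; lra.
have tB : t * B < e.
  by rewrite /t mulrAC ltr_pdivrMr // ltr_pM2l //; lra.
exists t; split=> //; apply: le_lt_trans (_ : ((t * B)%:E < _)%E); last first.
  by rewrite lte_fin.
apply: functional_norm_le => [|x hx]; first by rewrite mulr_ge0 // ltW.
rewrite vecfun_line.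
have -> : vecfun xi x + t%:C * (inner H (x w) xi + inner H (x xi) w) +
    (t ^+ 2)%:C * vecfun w x - vecfun xi x =
    t%:C * (inner H (x w) xi + inner H (x xi) w + t%:C * vecfun w x).
  by rewrite rmorphXn /=; ring.
rewrite sqnM sqn_real [leRHS]exprMn ler_wpM2l ?sqr_ge0 //.
have -> : B = r * s + s * r + r ^+ 2 by rewrite /B; ring.
apply: sqn_add_le; rewrite ?addr_ge0 ?mulr_ge0 ?sqr_ge0 //.
  by apply: sqn_add_le; rewrite ?mulr_ge0 //; exact: sqn_inner_le.
rewrite sqnM sqn_real -[leRHS]mul1r ler_pM ?sqr_ge0 ?sqn_ge0 //.
  by rewrite expr_le1 // ltW.
by rewrite [r ^+ 2]expr2; apply: sqn_inner_le.
Qed.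
End Nilpotent.

Section NoNilpotent.
Context {R : realType} {H : hilbertSpace R} {M : vonNeumannAlgebra H}.
Implicit Types (x y z : M) (u v w : H).

(** By the parallelogram law the functional of [xi + t w] is at most twice that of [xi] plus twice
    that of [t w]. Listing each vector twice thus gives one interval for all [t] in [0, 1]. *)
Lemma vecfun_line_interval (xi w : H) : exists2 phi : predual M,
  positive_functional phi & forall t : R, 0 <= t -> t <= 1 ->
    exists psi : order_interval phi, forall x, psi x = vecfun (xi + t%:C *: w) x.
Proof.
pose phi := Predual (@vecfun_sum_normal R H M [:: xi; xi; w; w]).
have phiE x : phi x = 2 * vecfun xi x + 2 * vecfun w x.
  by rewrite /= !big_cons big_nil; ring.
exists phi => [x x0|t t0 t1].
  by rewrite phiE addr_ge0 ?mulr_ge0 //; exact: vecfun_pos.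
apply: (@itv_ex _ _ _ phi (vecfun (xi + t%:C *: w))) => [||x x0].
- exact: vecfun_scalar.
- exact: vecfun_pos.
rewrite phiE.
have P := positive_form x0; have qE u : vecfun u x = (qf (fun u v => inner H (x u) v) u)%:C.
  exact: (qfE P).
rewrite !qE -mulrDr -(rmorph_nat (real_complex R)) -rmorphD -rmorphM lecR.
apply: le_trans (qfD_le P _ _) _; rewrite ler_pM2l // lerD2l (qfZ P).
rewrite /sqn /= expr0n addr0 -[leRHS]mul1r ler_wpM2r ?(qf_ge0 P) //.
by rewrite expr_le1.
Qed.

Lemma no_nilpotent : (forall phi : predual M, positive_functional phi ->
    norm_opens phi = order_opens (order_interval phi)) ->
  forall a : M, vmul a a = 0 -> a = 0.
Proof.
move=> Heq a aa; apply: contrapT => /eqP a0.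
have [xi axi aaxi] := nilpotent_vector a0 aa.
have aav v : a (a v) = 0 by rewrite -[LHS]/(vmul a a v) aa.
pose w := a xi; pose om (t : R) := vecfun (M := M) (xi + t%:C *: w).
have [phi phi0 om_itv] := vecfun_line_interval xi w.
pose kappa := nsq w.
have k0 : 0 < kappa.
  rewrite lt_neqAle nsq_ge0 andbT eq_sym; apply/eqP => /nsq_eq0 w0.
  by apply: aaxi; rewrite -/w w0 v0.
(* Evaluation at a^* recovers the parameter [t]: since a^* xi = 0 and a w = 0, only t <w, w>
   survives. *)
have om_adj t : complex.Re (om t (vadj a)) = t * kappa.
  rewrite /om /vecfun vD vZ axi add0r innerZl vadjP' vD vZ aav scaler0 addr0.
  by rewrite (qfE inner_psd) !cE mul0r subr0.
have om0 : om 0 = vecfun xi.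
  by apply/funext => x; rewrite /om scale0r addr0.
have [psi0 psi0E] := om_itv 0 (lexx _) ler01.
pose X := [set chi : order_interval phi |
  exists t : R, [/\ 0 < t, t <= 1 & forall x, chi x = om t x]].
(* An order limit [chi] is a norm limit of functionals [om (t n)]. The coordinate at a^* makes [t n]
   converge to some [s], so [chi] is [om s], and only [s = 0] leads outside [X]. *)
have X_closed : order_closed X.
  move=> d' G u chi Gdir uX uchi.
  have close (n : nat) : exists t : R, [/\ 0 < t, t <= 1 &
      (functional_norm (fun x : M => om t x - chi x)%R < (n.+1%:R^-1 : R)%:E)%E].
    have n0 : 0 < n.+1%:R^-1 :> R by rewrite invr_gt0.
    have [g hg] := order_converges_norm Gdir uchi n0.
    have [t [t0 t1 ut]] := uX g; exists t; split=> //.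
    by move: hg; under eq_fun do rewrite ut.
  have [t tP] := choice close.
  have subL n : scalar (fun x => om (t n) x - chi x).
    by move=> b x y; rewrite /om vecfun_scalar itv_scalar mulrBr opprD addrACA.
  have om_chi x : (fun n => om (t n) x : R[i]^o) @ \oo --> (chi x : R[i]^o).
    have [K K0 hK] := vbounded x.
    apply/cvgC_sqn.
    have hb : (fun n => (n.+1%:R^-1 * K) ^+ 2) @ \oo --> (0 : R).
      have hb1 : (fun n => n.+1%:R^-1 * K) @ \oo --> (0 : R).
        rewrite -[X in _ --> X](mul0r K); apply: cvgMr_tmp.
        exact: (@cvg_harmonic R).
      rewrite -[X in _ --> X](mul0r (0 : R)).
      rewrite (_ : (fun n => _) = (fun n => (n.+1%:R^-1 * K) * (n.+1%:R^-1 * K))).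
        exact: cvgM.
      by apply/funext => n; rewrite expr2.
    apply: squeeze_cvgr (@cvg_cst _ _ _ _ _) hb; near=> n.
    rewrite sqn_ge0 /=; have [_ _ hn] := tP n.
    exact: (functional_norm_scale (subL n) K0 hn hK).
  pose s := complex.Re (chi (vadj a)) / kappa.
  have ts : t @ \oo --> s.
    rewrite (_ : t = (fun n => complex.Re (om (t n) (vadj a)) / kappa)).
      by apply: cvgMr_tmp; exact: cvgC_Re.
    by apply/funext => n; rewrite om_adj mulfK // gt_eqF.
  have s0 : 0 <= s.
    by apply: (cvgr_to_ge ts); near=> n; have [/ltW] := tP n.
  have s1 : s <= 1.
    by apply: (cvgr_to_le ts); near=> n; have [_] := tP n.
  have chiE x : chi x = om s x.
    have hs : (fun n => om (t n) x : R[i]^o) @ \oo --> (om s x : R[i]^o).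
      exact: vecfun_line_cvg.
    by apply: (cvg_unique (T := R[i]^o) _ (om_chi x) hs).
  have [s_gt0|s_le0] := ltP 0 s; first by exists s.
  have sE : s = 0 by apply/le_anti/andP.
  have chiE0 x : chi x = vecfun xi x by rewrite chiE sE om0.
  (* If s = 0, each [y g] lies below both [chi = om 0] and some [om t'] with t' > 0, hence vanishes
     at [A]; yet these values approach [chi A > 0]. *)
  exfalso; pose A : M := vsq (vmul (vadj a) a).
  have A0 : positive_operator A by exact: positive_adjM.
  have chiA : 0 < complex.Re (chi A).
    rewrite chiE0 /vecfun vE vadjP' (qfE inner_psd) /= -/(nsq _).
    rewrite lt_neqAle nsq_ge0 andbT eq_sym; apply/eqP => /nsq_eq0; exact: aaxi.
  have [y [z [yuz ypsi _]]] := uchi.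
  have [g hg] := itv_monotone Gdir ypsi A0 chiA.
  have [t' [t'0 t'1 ut']] := uX g.
  suff yA : complex.Re (y g A) = 0 by move: hg; rewrite yA subr0 ltxx.
  apply: (@dominated_vec_eq0 _ _ _ (y g) a xi t') => //.
  - exact: itv_scalar.
  - exact: itv_pos.
  - by rewrite gt_eqF.
  - move=> x x0; rewrite -chiE0; apply/itv_leP: x x0.
    by have [_ [+ _]] := ypsi; apply; exists g.
  - move=> x x0; have [/itv_leP/(_ x x0) + _] := yuz g.
    by rewrite ut'.
have oX : norm_opens phi (~` X).
  by rewrite (Heq phi phi0) /order_opens /= setCK.
have X0 : (~` X) psi0.
  move=> [t [t0 t1 tE]]; have := om_adj t; rewrite -tE psi0E -/(om 0) om_adj mul0r.
  by move=> /esym/eqP; rewrite mulf_eq0 !gt_eqF.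
have [e e0 he] := oX psi0 X0.
have [t [t0 t1 ht]] := @functional_norm_line R H M xi w e e0.
have [psi psiE] := om_itv t (ltW t0) t1.
have : (~` X) psi.
  apply: he; move: ht; congr (functional_norm _ < _)%E.
  by apply/funext => x; rewrite psiE psi0E -/(om 0) om0.
by apply; exists t; split.
Unshelve. all: by end_near. Qed.
End NoNilpotent.

(** * Square roots and projections *)

Section Nrm.
Context {R : realType} {H : hilbertSpace R}.
Implicit Types u v w : H.

Definition nrm v : R := Num.sqrt (nsq v).

Lemma nrm_ge0 v : 0 <= nrm v. Proof. exact: sqrtr_ge0. Qed.

Lemma nrm_sqr v : nrm v ^+ 2 = nsq v. Proof. by rewrite sqr_sqrtr ?nsq_ge0. Qed.

Lemma nrmD u v : nrm (u + v) <= nrm u + nrm v.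
Proof. by rewrite -lecR rmorphD /= -!norm_nsq ler_normD. Qed.

Lemma nsqZ (a : R[i]) v : nsq (a *: v) = sqn a * nsq v.
Proof. exact: qfZ inner_psd _ _. Qed.

Lemma nrmZ (a : R) v : 0 <= a -> nrm (a%:C *: v) = a * nrm v.
Proof.
by move=> a0; rewrite /nrm nsqZ sqn_real sqrtrM ?sqr_ge0 // sqrtr_sqr ger0_norm.
Qed.

Lemma nrmN v : nrm (- v) = nrm v.
Proof. by rewrite /nrm -scaleN1r nsqZ /sqn !cE /= oppr0 expr0n addr0 sqrrN expr1n mul1r. Qed.

Lemma nrm_le (K : R) u v : 0 <= K -> (nrm u <= K * nrm v) = (nsq u <= K ^+ 2 * nsq v).
Proof.
by move=> K0; rewrite -!nrm_sqr -exprMn ler_pXn2r ?nnegrE ?mulr_ge0 ?nrm_ge0.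
Qed.

Lemma cvgH_nrm (u : nat -> H) l : (fun n => nrm (u n - l)) @ \oo --> (0 : R) -> u @ \oo --> l.
Proof.
move=> h; apply/cvgH_nsq; rewrite -[X in _ --> X](mul0r (0 : R)).
rewrite (_ : (fun n => _) = (fun n => nrm (u n - l) * nrm (u n - l))).
  exact: cvgM.
by apply/funext => n; rewrite -expr2 nrm_sqr.
Qed.

Lemma nrm_cvg (u : nat -> H) l : u @ \oo --> l -> (fun n => nrm (u n - l)) @ \oo --> (0 : R).
Proof.
move=> /cvgH_nsq h; apply/cvgrPdistC_lt => e e0.
have /(cvgr_lt _ h) : 0 < e ^+ 2 by rewrite exprn_gt0.
apply: filterS => n hn.
by rewrite subr0 ger0_norm ?nrm_ge0 // -ltr_sqr ?nnegrE ?nrm_ge0 ?ltW // nrm_sqr.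
Qed.
End Nrm.

Section Sqrt.
Context {R : realType} {H : hilbertSpace R} {M : vonNeumannAlgebra H}.
Implicit Types (x y z : M) (u v w : H).

Lemma vna_cvg x (u : nat -> H) l : u @ \oo --> l -> (fun n => x (u n)) @ \oo --> x l.
Proof.
by move=> ul; have [_ cx] := vna_bounded (vna_in x); apply: cvg_comp ul (cx l).
Qed.

(** Commuting with each element of the commutant passes to pointwise limits, so the bicommutant
    property keeps the limit in [M]. *)
Lemma vna_lim (Y : nat -> M) (K : R) : (forall v, cvgn (fun n => Y n v)) ->
  (forall n v, nsq (Y n v) <= K * nsq v) ->
  exists y : M, forall v, (fun n => Y n v) @ \oo --> y v.
Proof.
move=> cY bY; pose y v := limn (fun n => Y n v).
have Yy v : (fun n => Y n v) @ \oo --> y v by exact: cY.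
have yL : linear y.
  move=> a u v; apply: (cvg_unique _ (Yy (a *: u + v))) => //.
  rewrite (_ : (fun n => _) = (fun n => a *: Y n u + Y n v)).
    have h1 : (fun n => a *: Y n u) @ \oo --> a *: y u by apply: cvgZl_tmp; exact: Yy.
    exact: (cvgD h1 (Yy v)).
  by apply/funext => n; rewrite vlin.
have yB : bounded_operator y.
  apply: (nsq_bounded_operator (K := K)) => // v.
  apply: (cvgr_to_le (nsq_cvg (Yy v))); near=> n; exact: bY.
have yM : vna_set M y.
  rewrite -vna_bicommutant; split=> // m [[mL mc] mM].
  apply/funext => v /=; apply: (cvg_unique _ (Yy (m v))) => //.
  rewrite (_ : (fun n => _) = (fun n => m (Y n v))); first exact: cvg_comp (Yy v) (mc _).
  by apply/funext => n; have /(congr1 (@^~ v)) := mM _ (vna_in (Y n)).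
by exists (VNAElt (mem_set yM)).
Unshelve. all: by end_near. Qed.

(** The equation Y = (c + Y^2)/2 is equivalent to (1 - Y)^2 = 1 - c, so 1 minus the limit is a
    square root of 1 - c. *)
Fixpoint sq_seq (c : M) n : M :=
  if n is n'.+1 then (2^-1 : R)%:C *: (c + vmul (sq_seq c n') (sq_seq c n')) else 0.

(** The same iteration at the scalar c = 1. Its increments majorize those of [sq_seq] for a
    contraction [c]. *)
Fixpoint sq_num n : R := if n is n'.+1 then 2^-1 * (1 + sq_num n' ^+ 2) else 0.

Lemma sq_num01 n : 0 <= sq_num n <= 1.
Proof.
elim: n => [|n /andP[h0 h1]] /=; first by rewrite lexx ler01.
by apply/andP; split; nra.
Qed.

Lemma sq_num_incr n : sq_num n <= sq_num n.+1.
Proof.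
rewrite /=; have /andP[h0 h1] := sq_num01 n.
by have := sqr_ge0 (sq_num n - 1); nra.
Qed.

Lemma sq_num_homo : {homo sq_num : m n / (m <= n)%N >-> m <= n}.
Proof. by apply: homo_leq => // [m n p|n]; [exact: le_trans|exact: sq_num_incr]. Qed.

Lemma sq_seq_comm c y n : vmul y c = vmul c y ->
  vmul y (sq_seq c n) = vmul (sq_seq c n) y.
Proof.
move=> yc; elim: n => [|n ih] /=; first by rewrite !vmul_lin.
by rewrite !vmul_lin yc vmulA ih -vmulA ih vmulA.
Qed.

Lemma sq_seq_adj c n : vadj c = c -> vadj (sq_seq c n) = sq_seq c n.
Proof.
move=> cc; elim: n => [|n ih] /=.
  by apply: (addrI (vadj 0)); rewrite -vadjD !addr0.
by rewrite !vadjE ih cc conj_real.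
Qed.

Section Contraction.
Variable c : M.
Hypothesis c1 : forall v, nsq (c v) <= nsq v.

Lemma contr_nrm v : nrm (c v) <= nrm v.
Proof. by have := nrm_le (c v) v ler01; rewrite mul1r expr1n mul1r c1. Qed.

Lemma sq_seq_nrm n v : nrm (sq_seq c n v) <= sq_num n * nrm v.
Proof.
elim: n v => [|n ih] v.
  by rewrite -[sq_seq c 0 v]/(0 : H) mul0r /nrm nsq0 sqrtr0.
rewrite [sq_num _]/= [sq_seq _ _]/= !vE nrmZ ?invr_ge0 // -mulrA ler_wpM2l ?invr_ge0 //.
apply: le_trans (nrmD _ _) _; rewrite mulrDl mul1r lerD ?contr_nrm //.
apply: le_trans (ih _) _; rewrite expr2 -mulrA ler_wpM2l //.
by have /andP[] := sq_num01 n.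
Qed.

Lemma sq_seq_nrm1 n v : nrm (sq_seq c n v) <= nrm v.
Proof.
apply: le_trans (sq_seq_nrm n v) _; rewrite -[leRHS]mul1r ler_wpM2r ?nrm_ge0 //.
by have /andP[] := sq_num01 n.
Qed.

(** Consecutive iterates commute, so Y_(n+2) - Y_(n+1) = (Y_(n+1) + Y_n)(Y_(n+1) - Y_n)/2. The
    scalar iteration obeys the same identity, and the bounds multiply. *)
Lemma sq_seq_step n v : nrm (sq_seq c n.+1 v - sq_seq c n v) <=
  (sq_num n.+1 - sq_num n) * nrm v.
Proof.
elim: n => [|n ih].
  rewrite -[sq_seq c 0 v]/(0 : H) -[sq_seq c 1 v]/((2^-1 : R)%:C *: (c v + 0)).
  rewrite [sq_num _]/= [sq_num _]/= !subr0 addr0 nrmZ ?invr_ge0 // expr0n addr0 mulr1.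
  by rewrite ler_wpM2l ?invr_ge0 // contr_nrm.
set Y1 := sq_seq c n.+1; set Y0 := sq_seq c n.
have comm : vmul Y1 Y0 = vmul Y0 Y1.
  by apply: sq_seq_comm; apply/esym/sq_seq_comm.
have -> : sq_seq c n.+2 v - Y1 v = (2^-1 : R)%:C *: (Y1 (Y1 v - Y0 v) + Y0 (Y1 v - Y0 v)).
  have cv : Y1 (Y0 v) = Y0 (Y1 v) by rewrite -[LHS]/(vmul Y1 Y0 v) comm.
  transitivity ((2^-1 : R)%:C *: (c v + Y1 (Y1 v)) - (2^-1 : R)%:C *: (c v + Y0 (Y0 v))).
    by [].
  rewrite -scalerBr; congr (_ *: _).
  rewrite !(vD, vN) cv opprD addrACA subrr add0r.
  by rewrite addrA subrK.
rewrite nrmZ ?invr_ge0 //.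
have -> : sq_num n.+2 - sq_num n.+1 =
    2^-1 * ((sq_num n.+1 + sq_num n) * (sq_num n.+1 - sq_num n)).
  rewrite -[sq_num n.+2]/(2^-1 * (1 + sq_num n.+1 ^+ 2)).
  by rewrite [in X in _ - X]/=; ring.
rewrite -!mulrA ler_wpM2l ?invr_ge0 //.
apply: le_trans (nrmD _ _) _; rewrite mulrDl.
have /andP[a0 _] := sq_num01 n.+1; have /andP[b0 _] := sq_num01 n.
apply: lerD; apply: le_trans (sq_seq_nrm _ _) _; exact: ler_wpM2l ih.
Qed.

Lemma sq_seq_diff m n v : (n <= m)%N -> nrm (sq_seq c m v - sq_seq c n v) <=
  (sq_num m - sq_num n) * nrm v.
Proof.
move=> /subnK <-; elim: (m - n)%N => [|k ih].
  by rewrite add0n !subrr mul0r /nrm nsq0 sqrtr0.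
rewrite addSn -[X in nrm X](subrKA (sq_seq c (k + n) v)).
apply: le_trans (nrmD _ _) _; apply: le_trans (lerD (sq_seq_step _ _) ih) _.
by rewrite -mulrDl subrKA.
Qed.

Lemma sq_seq_cvg v : cvgn (fun n => sq_seq c n v).
Proof.
apply: cauchyH => e e0.
have tc : cvgn sq_num.
  apply: nondecreasing_is_cvgn; first exact: sq_num_homo.
  by exists 1 => _ [n _ <-]; have /andP[] := sq_num01 n.
(* With d <= 1 the squared bound d^2 |v|^2 is at most d |v|^2, which is below e. *)
pose d := e / (nsq v + e + 1).
have v0 := nsq_ge0 v; have D0 : 0 < nsq v + e + 1 by lra.
have d0 : 0 < d by rewrite divr_gt0.
have d1 : d <= 1 by rewrite ler_pdivrMr // mul1r; lra.
have dv : d * nsq v < e.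
  by rewrite /d mulrAC ltr_pdivrMr // ltr_pM2l //; lra.
have lub n : sq_num n <= limn sq_num.
  by apply: nondecreasing_cvgn_le => //; exact: sq_num_homo.
have [|N _ hN] := cvgr_gt _ tc (limn sq_num - d); first by rewrite ltrBlDr ltrDl.
have key m n : (N <= n)%N -> (n <= m)%N -> nsq (sq_seq c m v - sq_seq c n v) < e.
  move=> Nn nm; apply: le_lt_trans dv.
  have : nrm (sq_seq c m v - sq_seq c n v) <= d * nrm v.
    apply: le_trans (sq_seq_diff _ nm) _; rewrite ler_wpM2r ?nrm_ge0 //.
    by have := lub m; have := hN n Nn; rewrite /=; lra.
  rewrite nrm_le ?(ltW d0) // => h; apply: le_trans h _.
  by rewrite ler_wpM2r // expr2 ler_piMr // ltW.
exists N => m n Nm Nn; have [nm|/ltnW mn] := leqP n m; first exact: key.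
rewrite -opprB /nsq -scaleN1r -/(nsq _) nsqZ.
have -> : sqn (-1 : R[i]) = 1 by rewrite /sqn !cE /= oppr0 expr0n addr0 sqrrN expr1n.
by rewrite mul1r; exact: key.
Qed.

(** The root is 1 - Y with Y the limit of polynomials in [c], whence the commutation clause. Each
    iterate is a contraction, so Y is one too, and 1 - Y is positive when self-adjoint. *)
Lemma vsqrt : exists s : M, [/\ vmul s s = vone M - c,
  forall y, vmul y c = vmul c y -> vmul y s = vmul s y,
  vadj c = c -> vadj s = s & vadj c = c -> positive_operator s].
Proof.
have [|Y hY] := @vna_lim (sq_seq c) 1 sq_seq_cvg.
  by move=> n v; have := nrm_le (sq_seq c n v) v ler01;
    rewrite expr1n => <-; rewrite mul1r sq_seq_nrm1.
have YY v : Y (Y v) = 2 *: Y v - c v.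
  have h1 : (fun n => sq_seq c n (sq_seq c n v)) @ \oo --> Y (Y v).
    apply: cvgH_nrm.
    have h2 : (fun n => nrm (sq_seq c n v - Y v) + nrm (sq_seq c n (Y v) - Y (Y v)))
        @ \oo --> (0 : R).
      by rewrite -[X in _ --> X](addr0 (0 : R)); apply: cvgD; apply: nrm_cvg.
    apply: squeeze_cvgr (@cvg_cst _ _ _ _ _) h2; near=> n.
    rewrite nrm_ge0 /= -[X in nrm X](subrKA (sq_seq c n (Y v))).
    apply: le_trans (nrmD _ _) _; rewrite lerD2r.
    have -> : sq_seq c n (sq_seq c n v) - sq_seq c n (Y v) =
      sq_seq c n (sq_seq c n v - Y v) by rewrite vD vN.
    exact: sq_seq_nrm1.
  apply: (cvg_unique _ h1) => //.
  rewrite (_ : (fun n => _) = (fun n => 2 *: sq_seq c n.+1 v - c v)).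
    apply: cvgB; last exact: cvg_cst.
    by apply: cvgZl_tmp; have := hY v; rewrite -(cvg_shiftS (fun n => sq_seq c n v)).
  apply/funext => n.
  rewrite -[sq_seq c n.+1 v]/((2^-1 : R)%:C *: (c v + sq_seq c n (sq_seq c n v))) scalerA.
  have -> : 2 * (2^-1 : R)%:C = 1 :> R[i].
    by rewrite -(rmorph_nat (real_complex R)) -rmorphM divff ?pnatr_eq0.
  by rewrite scale1r addrC addKr.
have Yadj : vadj c = c -> vadj Y = Y.
  move=> cc; apply: vadj_uniq => v w.
  have h1 : (fun n => inner H (sq_seq c n v) w : R[i]^o) @ \oo --> (inner H (Y v) w : R[i]^o).
    by apply: inner_cvg; exact: hY.
  have h2 : (fun n => inner H (sq_seq c n w) v : R[i]^o) @ \oo --> (inner H (Y w) v : R[i]^o).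
    by apply: inner_cvg; exact: hY.
  have E n : inner H (sq_seq c n v) w = Num.conj (inner H (sq_seq c n w) v).
    by rewrite vadjP sq_seq_adj // -innerC.
  rewrite (innerC v); apply: complexP; rewrite ?ReJ ?ImJ.
    apply: (cvg_unique (T := R) _ (cvgC_Re h1)) => //.
    rewrite (_ : (fun n => _) = (fun n => complex.Re (inner H (sq_seq c n w) v))).
      by apply: cvgC_Re; exact: h2.
    by apply/funext => n; rewrite E ReJ.
  apply: (cvg_unique (T := R) _ (cvgC_Im h1)) => //.
  rewrite (_ : (fun n => _) = (fun n => - complex.Im (inner H (sq_seq c n w) v))).
    by apply: cvgN; apply: cvgC_Im; exact: h2.
  by apply/funext => n; rewrite E ImJ.
exists (vone M - Y); split.
- apply: vna_ext => v; rewrite !vE !(vD, vN) YY.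
  rewrite (_ : 2 = 1 + 1 :> R[i]) // scalerDl !scale1r.
  by rewrite opprB [X in _ + X]addrAC addrK addrA subrK.
- move=> y yc; rewrite !vmul_lin !vmul1l !vmul1r; congr (_ - _).
  apply: vna_ext => v; rewrite !vE.
  have h1 : (fun n => y (sq_seq c n v)) @ \oo --> y (Y v).
    by apply: vna_cvg; exact: hY.
  apply: (cvg_unique _ h1) => //.
  rewrite (_ : (fun n => _) = (fun n => sq_seq c n (y v))); first exact: hY.
  by apply/funext => n; rewrite -[LHS]/(vmul y (sq_seq c n) v) sq_seq_comm.
- by move=> cc; rewrite !vadjE Yadj.
- move=> cc v; have Yv : Num.conj (inner H (Y v) v) = inner H (Y v) v.
    by rewrite -innerC -{2}(Yadj cc) vadjP'.
  rewrite !vE !innerE (qfE inner_psd) lecE !cE.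
  have -> : complex.Im (inner H (Y v) v) = 0.
    by move: Yv => /(congr1 (@complex.Im R)); rewrite ImJ; lra.
  rewrite oppr0 addr0 eqxx /= subr_ge0 -[leRHS]mul1r.
  apply: bounded_inner_le => // w; rewrite expr1n mul1r.
  apply: (cvgr_to_le (nsq_cvg (hY w))); near=> n.
  by have := nrm_le (sq_seq c n w) w ler01; rewrite expr1n !mul1r sq_seq_nrm1.
Unshelve. all: by end_near. Qed.
End Contraction.
End Sqrt.

Section Calculus.
Context {R : realType} {H : hilbertSpace R} {M : vonNeumannAlgebra H}.
Implicit Types (x y z : M) (u v w : H).

Lemma vadj_real (a : R) x : vadj (a%:C *: x) = a%:C *: vadj x.
Proof. by rewrite vadjZ conj_real. Qed.

Lemma vabs x : vadj x = x -> exists h : M, [/\ positive_operator h,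
  vmul h h = vmul x x & forall y, vmul y x = vmul x y -> vmul y h = vmul h y].
Proof.
move=> xx; have [K K0 hK] := vbounded x.
have [x1 x1E] : exists x1 : M, x1 = K^-1%:C *: x by exists (K^-1%:C *: x).
have [c cE] : exists c : M, c = vone M - vmul x1 x1 by exists (vone M - vmul x1 x1).
have x1a : vadj x1 = x1 by rewrite x1E vadj_real xx.
have x1c v : nsq (x1 v) <= nsq v.
  by rewrite x1E vE nsqZ sqn_real exprVn ler_pdivrMl ?exprn_gt0.
have ca : vadj c = c by rewrite cE vadjD vadjN vadjM vadj1 x1a.
(* For self-adjoint [x1], |v - x1 x1 v|^2 = |v|^2 - 2 |x1 v|^2 + |x1 x1 v|^2, and the last term is
   at most |x1 v|^2. *)
have c1 v : nsq (c v) <= nsq v.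
  have E : inner H v (x1 (x1 v)) = (nsq (x1 v))%:C.
    by rewrite -(vadjP' x1 v (x1 v)) x1a (qfE inner_psd).
  rewrite cE -[(vone M - vmul x1 x1) v]/(v - x1 (x1 v)).
  rewrite /nsq (qfB inner_psd) -!/(nsq _) E Re_real.
  by have := x1c (x1 v); have := nsq_ge0 (x1 v); lra.
have [s [ss scomm sa s0]] := vsqrt c1.
exists (K%:C *: s); split.
- by apply: positive_scale (ltW K0) (s0 ca).
- rewrite !vmul_lin ss cE opprB addrC subrK x1E !vmul_lin !scalerA.
  have -> : K%:C * K%:C * K^-1%:C * K^-1%:C = 1 :> R[i].
    by rewrite -!rmorphM; congr (_%:C); field; rewrite gt_eqF.
  by rewrite scale1r.
- move=> y yx; rewrite !vmul_lin scomm // cE !vmul_lin !vmul1l !vmul1r x1E !vmul_lin.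
  congr (_ - _ *: (_ *: _)).
  by rewrite vmulA yx -vmulA yx vmulA.
Qed.

Lemma vpos_sqrt x : positive_operator x -> exists s : M, [/\ vadj s = s,
  vmul s s = x & forall y, vmul y x = vmul x y -> vmul y s = vmul s y].
Proof.
move=> x0; have [K K0 hK] := vbounded x.
have [c cE] : exists c : M, c = vone M - K^-1%:C *: x.
  by exists (vone M - K^-1%:C *: x).
have K1 : 0 <= K^-1 by rewrite invr_ge0 ltW.
have c0 : positive_operator c.
  have := positive_scale K1 (positive_bound (ltW K0) x0 hK).
  by rewrite cE scalerBr scalerA -rmorphM mulVf ?gt_eqF // scale1r.
have c1 : positive_operator (vone M - c).
  by rewrite cE opprB addrC subrK; exact: positive_scale.
have [s [ss scomm sa _]] := vsqrt (positive_le1_contract c0 c1).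
have sK : 0 <= Num.sqrt K by exact: sqrtr_ge0.
exists ((Num.sqrt K)%:C *: s); split.
- by rewrite vadj_real sa //; exact: positive_adj.
- rewrite !vmul_lin ss cE opprB addrC subrK !scalerA.
  have -> : (Num.sqrt K)%:C * (Num.sqrt K)%:C * K^-1%:C = 1 :> R[i].
    by rewrite -!rmorphM -expr2 sqr_sqrtr ?(ltW K0) // divff // gt_eqF.
  by rewrite scale1r.
- move=> y yx; rewrite !vmul_lin scomm // cE !vmul_lin !vmul1l !vmul1r.
  by rewrite yx.
Qed.

(** With s the square root of [x], which commutes with [y], the product equals s y s. *)
Lemma positive_mul x y : positive_operator x -> positive_operator y ->
  vmul y x = vmul x y -> positive_operator (vmul x y).
Proof.
move=> x0 y0 xy; have [s [sa ss scomm]] := vpos_sqrt x0.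
have := scomm _ xy => sy v; rewrite -ss.
rewrite -vmulA -sy !vE -{1}sa vadjP'; exact: y0.
Qed.

(** The complementary projection, onto the closed range of [c], is obtained first: Riesz for the
    form <c u, c w> and the functional <c u, v> gives vectors [w n] with [c (w n)] converging to the
    projection of [v]. The last clause keeps this approximation for [bisection]. *)
Lemma kernel_projection c : vadj c = c -> exists e : M, [/\ vadj e = e, vmul e e = e,
  vmul c e = 0 & forall v, exists w : nat -> H, (fun n => c (w n)) @ \oo --> v - e v].
Proof.
move=> ca.
have qP : psd_form (fun u w => inner H (c u) (c w)).
  split=> [w a u v|u a v w|u]; last by rewrite inner_norm exprn_ge0.
    by rewrite !vopE !innerE.
  by rewrite !vopE !innerE.
(* [f] is the orthogonal projection of [v] onto the closed range of [c]: the kernel of the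
   self-adjoint [c] is the orthogonal complement of its range. *)
pose P v f := c (v - f) = 0 /\ exists w : nat -> H, (fun n => c (w n)) @ \oo --> f.
have exP v : exists f, P v f.
  have [|||w [w_cauchy w_lim]] := form_riesz qP (h := fun u => inner H (c u) v) (B := nsq v).
  - by move=> a u u'; rewrite !vopE !innerE.
  - exact: nsq_ge0.
  - by move=> u; rewrite mulrC; exact: form_CS inner_psd _ _.
  have d0 := @cvg_2harmonic R.
  have : cvgn (fun n => c (w n)).
    apply: cauchyH => e e0; have e2 : 0 < e / 2 by rewrite divr_gt0.
    have [N _ hN] := cvgr_lt _ d0 _ e2.
    exists N => m n Nm Nn; rewrite -vN -vD.
    apply: le_lt_trans (w_cauchy m n) _; rewrite mulrDr [ltRHS]splitr.
    exact: ltrD (hN _ Nm) (hN _ Nn).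
  move=> /cvg_ex[f cf]; exists f; split; last by exists w.
  apply: inner_inj => u; rewrite [RHS]innerC inner0l rmorph0.
  rewrite -{1}ca -vadjP innerDr innerNr; apply/eqP; rewrite subr_eq0; apply/eqP.
  have h1 : (fun n => inner H (c u) (c (w n)) : R[i]^o) @ \oo --> (inner H (c u) v : R[i]^o).
    apply/cvgC_sqn.
    have hb : (fun n => n.+1%:R^-1 * nsq (c u)) @ \oo --> (0 : R).
      rewrite -[X in _ --> X](mul0r (nsq (c u))); apply: cvgMr_tmp.
      exact: (@cvg_harmonic R).
    apply: squeeze_cvgr (@cvg_cst _ _ _ _ _) hb; near=> n.
    rewrite sqn_ge0 /=; apply: le_trans (w_lim n u).
    rewrite -opprB; have -> (z : R[i]) : sqn (- z) = sqn z by rewrite /sqn !cE !sqrrN.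
    by [].
  have h2 : (fun n => inner H (c (w n)) (c u) : R[i]^o) @ \oo --> (inner H f (c u) : R[i]^o).
    exact: inner_cvg.
  rewrite [RHS]innerC; apply: complexP; rewrite ?ReJ ?ImJ.
    apply: (cvg_unique (T := R) _ (cvgC_Re h1)) => //.
    rewrite (_ : (fun n => _) = (fun n => complex.Re (inner H (c (w n)) (c u)))).
      by apply: cvgC_Re; exact: h2.
    by apply/funext => n; rewrite innerC ReJ.
  apply: (cvg_unique (T := R) _ (cvgC_Im h1)) => //.
  rewrite (_ : (fun n => _) = (fun n => - complex.Im (inner H (c (w n)) (c u)))).
    by apply: cvgN; apply: cvgC_Im; exact: h2.
  by apply/funext => n; rewrite innerC ImJ.
have orth f g (w : nat -> H) : (fun n => c (w n)) @ \oo --> f -> c g = 0 -> inner H f g = 0.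
  move=> wf cg; apply: (cvg_unique (T := R[i]^o) _ (inner_cvg (w := g) wf)) => //.
  rewrite (_ : (fun n => _) = (fun=> 0)); first exact: cvg_cst.
  by apply/funext => n; rewrite vadjP ca cg innerC inner0l rmorph0.
have Puniq v f f' : P v f -> P v f' -> f = f'.
  move=> [cf [w wf]] [cf' [w' wf']].
  apply/eqP; rewrite -subr_eq0; apply/eqP/nsq_eq0.
  rewrite /nsq /qf (orth (f - f') (f - f') (fun n => w n - w' n)) //.
    rewrite (_ : (fun n => _) = (fun n => c (w n) - c (w' n))); first exact: cvgB.
    by apply/funext => n; rewrite vD vN.
  have -> : f - f' = (v - f') - (v - f) by rewrite opprB [RHS]addrC addrA subrK.
  by rewrite vD vN cf cf' subrr.
have [F FP] := choice exP.
have FL : linear F.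
  move=> a u v; apply: Puniq (FP _) _.
  have [cu [w wu]] := FP u; have [cv [w' wv]] := FP v; split.
    have -> : a *: u + v - (a *: F u + F v) = a *: (u - F u) + (v - F v).
      by rewrite scalerBr opprD addrACA.
    by rewrite vlin cu cv scaler0 addr0.
  exists (fun n => a *: w n + w' n).
  rewrite (_ : (fun n => _) = (fun n => a *: c (w n) + c (w' n))).
    have h1 : (fun n => a *: c (w n)) @ \oo --> a *: F u by apply: cvgZl_tmp; exact: wu.
    exact: (cvgD h1 wv).
  by apply/funext => n; rewrite vlin.
have FB : bounded_operator F.
  apply: (nsq_bounded_operator (K := 1)) => // v.
  have [cv [w wv]] := FP v; rewrite mul1r.
  have : nsq (F v + (v - F v)) = nsq (F v) + nsq (v - F v).
    by rewrite /nsq (qfD inner_psd) (orth _ _ w) // -[complex.Re 0]/(0 : R) mulr0 addr0.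
  by rewrite addrC subrK => ->; rewrite lerDl nsq_ge0.
(* An operator commuting with [c] preserves both clauses of [P], so by uniqueness it commutes with
   [F]. *)
have FM : vna_set M F.
  rewrite -vna_bicommutant; split=> // m [[mL mc] mM].
  have mc' u : m (c u) = c (m u) by have /(congr1 (@^~ u)) := mM _ (vna_in c).
  have m0 : m 0 = 0.
    by have := mL (-1) 0 0; rewrite scaler0 addr0 scaleN1r addNr.
  apply/funext => v /=; apply: Puniq (FP _) _.
  have [cv [w wv]] := FP v; split.
    have -> : m v - m (F v) = m (v - F v).
      rewrite [v - F v]addrC; have := mL (-1) (F v) v.
      by rewrite !scaleN1r => ->; rewrite addrC.
    by rewrite -mc' cv m0.
  exists (m \o w); rewrite (_ : (fun n => _) = (fun n => m (c (w n)))).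
    exact: cvg_comp wv (mc _).
  by apply/funext => n; rewrite mc'.
pose f : M := VNAElt (mem_set FM).
have fP v : P v (f v) by exact: FP.
have ff : vmul f f = f.
  apply: vna_ext => v; have [_ hw] := fP v.
  by apply: Puniq (fP (f v)) _; split=> //; rewrite subrr v0.
have cff v : c (f v) = c v.
  by have [+ _] := fP v; rewrite vD vN => /eqP; rewrite subr_eq0 => /eqP.
have fa : vadj f = f.
  have key v w : inner H (f v) w = inner H (f v) (f w).
    have [_ [s sv]] := fP v; have [cw _] := fP w.
    have := orth _ _ _ sv cw; rewrite innerDr innerNr => /eqP.
    by rewrite subr_eq0 => /eqP.
  by apply: vadj_uniq => v w; rewrite (key v w) [RHS]innerC (key w v) -innerC.
exists (vone M - f); split.
- by rewrite vadjD vadjN vadj1 fa.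
- by rewrite !vmul_lin !vmul1l !vmul1r ff subrr ?oppr0 addr0.
- by apply: vna_ext => v; rewrite !vE vD vN cff subrr.
- move=> v; have [_ [w wv]] := fP v; exists w.
  by rewrite !vE opprB addrC subrK.
Unshelve. all: by end_near. Qed.
End Calculus.

(** * An algebra without nilpotent elements is abelian *)

Section Commutative.
Context {R : realType} {H : hilbertSpace R} {M : vonNeumannAlgebra H}.
Implicit Types (x y z : M) (u v w : H).

Definition projection (p : M) := vadj p = p /\ vmul p p = p.

Lemma projection_compl p : projection p -> projection (vone M - p).
Proof.
move=> [pa pp]; split; first by rewrite vadjD vadjN vadj1 pa.
by rewrite !vmul_lin !vmul1l !vmul1r pp subrr ?oppr0 addr0.
Qed.

Lemma projection_pythagoras p v : projection p ->
  nsq v = nsq (p v) + nsq ((vone M - p) v).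
Proof.
move=> [pa pp]; have E : p v + (vone M - p) v = v by rewrite !vE addrC subrK.
rewrite -{1}E /nsq (qfD inner_psd) vadjP pa !vE vD vN -[p (p v)]/(vmul p p v) pp.
by rewrite subrr innerC inner0l rmorph0 -[complex.Re 0]/(0 : R) mulr0 addr0.
Qed.

Lemma projection_mul p q : projection p -> projection q -> vmul p q = vmul q p ->
  projection (vmul p q).
Proof.
move=> [pa pp] [qa qq] pq; split; first by rewrite vadjM pa qa pq.
by rewrite -vmulA (vmulA q) -pq -vmulA qq vmulA pp.
Qed.

Lemma nsqN v : nsq (- v) = nsq v.
Proof. by rewrite -!nrm_sqr nrmN. Qed.

(* Cauchy-Schwarz for the form [<h u, v>] gives [|hu|^2 <= r <hu, u>]. *)
Lemma abs_shift (h : M) (r : R) u : positive_operator h -> 0 <= r ->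
  nsq (h (h u)) <= r ^+ 2 * nsq (h u) ->
  nsq (h u - (r / 2)%:C *: u) <= (r / 2) ^+ 2 * nsq u.
Proof.
move=> h0 r0 hr; have hP := positive_form h0.
have key : nsq (h u) <= r * complex.Re (inner H (h u) u).
  have hh : complex.Re (inner H (h (h u)) (h u)) <= r * nsq (h u).
    apply: ler_of_sqr; first by rewrite mulr_ge0 ?nsq_ge0.
    apply: (@le_trans _ _ (nsq (h (h u)) * nsq (h u))).
      apply: le_trans (form_CS inner_psd _ _).
      by rewrite /sqn lerDl sqr_ge0.
    have -> : (r * nsq (h u)) ^+ 2 = r ^+ 2 * nsq (h u) * nsq (h u) by ring.
    by rewrite ler_wpM2r ?nsq_ge0.
  have := form_CS hP u (h u); rewrite (qfE inner_psd) sqn_real -/(nsq _).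
  have := qf_ge0 hP u; have := nsq_ge0 (h u); move: hh.
  rewrite -[complex.Re (inner H (h u) u)]/(qf (fun u v => inner H (h u) v) u).
  rewrite -[complex.Re (inner H (h (h u)) (h u))]/(qf (fun u v => inner H (h u) v) (h u)).
  move: (nsq (h u)) (qf _ u) (qf _ (h u)) => a b c ca a0 b0 aa.
  have [a_gt0|a_le0] := ltP 0 a; last by apply: le_trans a_le0 _; rewrite mulr_ge0.
  rewrite -(ler_pM2r a_gt0) -expr2; apply: le_trans aa _.
  by rewrite [r * b]mulrC -mulrA ler_wpM2l.
rewrite /nsq (qfB inner_psd) -!/(nsq _) nsqZ sqn_real innerZr conj_real.
rewrite !cE mul0r subr0.
move: key; move: (complex.Re _) (nsq (h u)) (nsq u) => a b c; nra.
Qed.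

Section Central.
Hypothesis central : forall p z, projection p -> vmul p z = vmul z p.
Variables (x z : M) (K : R).
Hypotheses (xa : vadj x = x) (K0 : 0 <= K) (hK : forall v, nsq (z v) <= K ^+ 2 * nsq v).

Let D := vmul x z - vmul z x.

Lemma nsq_sub_le u v (s t n : R) : 0 <= s -> 0 <= t -> 0 <= n ->
  nsq u <= s ^+ 2 * n -> nsq v <= t ^+ 2 * n -> nsq (u - v) <= (s + t) ^+ 2 * n.
Proof.
move=> s0 t0 n0 hu hv.
have h w c : 0 <= c -> nsq w <= c ^+ 2 * n -> nrm w <= c * Num.sqrt n.
  move=> c0 hw; apply: ler_of_sqr; first by rewrite mulr_ge0 ?sqrtr_ge0.
  by rewrite nrm_sqr exprMn sqr_sqrtr.
rewrite -nrm_sqr -(sqr_sqrtr n0) -exprMn ler_pXn2r ?nnegrE ?nrm_ge0 //.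
  by apply: le_trans (nrmD _ _) _; rewrite nrmN mulrDl lerD // h.
by rewrite mulr_ge0 ?sqrtr_ge0 ?addr_ge0.
Qed.

(** On the range of [p], [x] is within [r] of [mu]. With y = x - mu and h = |y|, the kernel
    projection [e] of h - y separates the part where y = h from the part where y = -h. On these [x]
    is within r/2 of mu + r/2 and of mu - r/2, which halves the radius. *)
Lemma bisection n (mu r : R) p : 0 <= r -> projection p ->
  (forall v, nsq (x (p v) - mu%:C *: p v) <= r ^+ 2 * nsq (p v)) ->
  forall v, nsq (D (p v)) <= (2^-1 ^+ n * (2 * r * K)) ^+ 2 * nsq (p v).
Proof.
elim: n mu r p => [|n ih] mu r p r0 pP hp v.
  have [pa pp] := pP.
  have zp u : z (p u) = p (z u) by rewrite -[LHS]/(vmul z p u) -central.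
  (* The commutator is unchanged when [mu] is subtracted from [x]; since [z] commutes with [p], each
     of the two products is at most r K. *)
  have -> : D (p v) = (x (z (p v)) - mu%:C *: z (p v)) - z (x (p v) - mu%:C *: p v).
    by rewrite vD vN vZ opprB addrA addrC -!addrA [X in _ + X]addrC !addrA subrK addrC.
  rewrite expr0 mul1r.
  have -> : 2 * r * K = r * K + r * K by ring.
  apply: nsq_sub_le; rewrite ?mulr_ge0 ?nsq_ge0 //.
    rewrite zp; apply: le_trans (hp _) _.
    have -> : (r * K) ^+ 2 * nsq (p v) = r ^+ 2 * (K ^+ 2 * nsq (p v)) by ring.
    by rewrite -zp ler_wpM2l ?sqr_ge0.
  apply: le_trans (hK _) _.
  have -> : (r * K) ^+ 2 * nsq (p v) = K ^+ 2 * (r ^+ 2 * nsq (p v)) by ring.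
  by rewrite ler_wpM2l ?sqr_ge0.
have [y yd] : exists y : M, y = x - mu%:C *: vone M by exists (x - mu%:C *: vone M).
have yE u : y u = x u - mu%:C *: u by rewrite yd.
have ya : vadj y = y by rewrite yd vadjD vadjN vadj_real vadj1 xa.
have [h [h0 hh hcomm]] := vabs ya.
have hy : vmul h y = vmul y h by rewrite hcomm.
have ha := positive_adj h0.
have nsq_hy u : nsq (h u) = nsq (y u).
  have nsqv (a : M) : vadj a = a -> nsq (a u) = complex.Re (inner H (a (a u)) u).
    by move=> aa; rewrite vadjP aa.
  rewrite !nsqv //.
  by rewrite -[h (h u)]/(vmul h h u) hh.
have ca : vadj (h - y) = h - y by rewrite vadjD vadjN ha ya.
have [e [ea ee ce ran_e]] := kernel_projection ca.
have eP : projection e by [].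
have hye u : h (e u) = y (e u).
  apply/eqP; rewrite -subr_eq0; apply/eqP.
  by rewrite -[LHS]/(vmul (h - y) e u) ce.
(* Since (h + y)(h - y) = 0, h + y vanishes on the closed range of h - y, which contains (1 - e)
   u. *)
have hyNe u : h ((vone M - e) u) = - y ((vone M - e) u).
  apply/eqP; rewrite -subr_eq0 opprK; apply/eqP.
  have [w wu] := ran_e u.
  have h1 : (fun n => (h + y) ((h - y) (w n))) @ \oo --> (h + y) (u - e u).
    by apply: vna_cvg.
  apply: (cvg_unique _ h1) => //.
  rewrite (_ : (fun n => _) = (fun=> 0)); first exact: cvg_cst.
  apply/funext => k; rewrite -[LHS]/(vmul (h + y) (h - y) (w k)).
  by rewrite !vmul_lin hh hy addrA subrK subrr.
have key u : p u = u -> nsq (h u - (r / 2)%:C *: u) <= (r / 2) ^+ 2 * nsq u.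
  move=> pu; apply: abs_shift => //.
  have pw : p (h u) = h u by rewrite -[LHS]/(vmul p h u) central // vE pu.
  by rewrite (nsq_hy (h u)) yE; have := hp (h u); rewrite pw.
have r20 : 0 <= r / 2 by rewrite divr_ge0.
have pe : vmul p e = vmul e p by exact: central.
have e'P := projection_compl eP.
have pe' : vmul p (vone M - e) = vmul (vone M - e) p by exact: central.
have h1 := ih (mu + r / 2) (r / 2) _ r20 (projection_mul pP eP pe).
have h2 := ih (mu - r / 2) (r / 2) _ r20 (projection_mul pP e'P pe').
have cD (q : M) : projection q -> forall w, D (q w) = q (D w).
  move=> qP w; rewrite -[LHS]/(vmul (vmul x z - vmul z x) q w).
  by rewrite -(central (vmul x z - vmul z x) qP).
have fold1 w : vmul p e w = e (p w) by rewrite pe.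
have fold2 w : vmul p (vone M - e) w = (vone M - e) (p w) by rewrite pe'.
have ppp w : p (p w) = p w by have [_ +] := pP; move/(congr1 (fun q : M => q w)).
have pfix w (q : M) : projection q -> p (q (p w)) = q (p w).
  by move=> qP; rewrite -[LHS]/(vmul p q (p w)) central // vE ppp.
(* [D] commutes with [e], so both sides split orthogonally and the bounds on the two halves combine
   without an extra factor. *)
rewrite (projection_pythagoras (D (p v)) eP) -!cD //.
rewrite [X in _ <= _ * X](projection_pythagoras (p v) eP) mulrDr.
have -> : 2^-1 ^+ n.+1 * (2 * r * K) = 2^-1 ^+ n * (2 * (r / 2) * K).
  by rewrite exprSr; field.
apply: lerD; [rewrite -!fold1; apply: h1|rewrite -!fold2; apply: h2] => w.
  rewrite fold1; have := key (e (p w)) (pfix w e eP); rewrite hye yE.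
  by rewrite rmorphD scalerDl opprD addrA.
rewrite fold2; have := key ((vone M - e) (p w)) (pfix w _ e'P); rewrite hyNe yE.
rewrite -(nsqN (- _ - _)) opprD !opprK rmorphB scalerBl opprB addrA addrAC.
exact.
Qed.
End Central.

Lemma central_comm : (forall p z, projection p -> vmul p z = vmul z p) ->
  forall x z, vadj x = x -> vmul x z = vmul z x.
Proof.
move=> central x z xa; have [K K0 hK] := vbounded z; have [r r0 hr] := vbounded x.
have oneP : projection (vone M) by split; [exact: vadj1|exact: vmul1l].
apply/eqP; rewrite -subr_eq0; apply/eqP; apply: vna_ext => v.
set D := vmul x z - vmul z x.
have bnd n : nsq (D v) <= (2^-1 ^+ n * (2 * r * K)) ^+ 2 * nsq v.
  apply: (bisection central xa (ltW K0) hK n (mu := 0) (ltW r0) oneP) => w.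
  by rewrite scale0r subr0 hr.
have lim0 : (fun n => (2^-1 ^+ n * (2 * r * K)) ^+ 2 * nsq v) @ \oo --> (0 : R).
  have g1 : (fun n => 2^-1 ^+ n * (2 * r * K)) @ \oo --> (0 : R).
    by rewrite -[X in _ --> X](mul0r (2 * r * K)); apply: cvgMr_tmp; exact: cvg_half.
  have g2 : (fun n => (2^-1 ^+ n * (2 * r * K)) * (2^-1 ^+ n * (2 * r * K))) @ \oo
      --> (0 : R).
    by rewrite -[X in _ --> X](mul0r (0 : R)); apply: cvgM.
  rewrite -[X in _ --> X](mul0r (nsq v)); apply: cvgMr_tmp.
  by rewrite (_ : (fun n => _) =
    (fun n => (2^-1 ^+ n * (2 * r * K)) * (2^-1 ^+ n * (2 * r * K)))).
apply: nsq_eq0; apply/le_anti; rewrite nsq_ge0 andbT.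
apply: (cvgr_to_ge lim0); near=> n; exact: bnd.
Unshelve. all: by end_near. Qed.

(** For a projection [q] the element (1 - q) z q squares to 0, hence vanishes, so [z] preserves the
    range of [q]. Applied to [p] and to 1 - p, this is commutation. *)
Lemma reduced_central : (forall a : M, vmul a a = 0 -> a = 0) ->
  forall p z, projection p -> vmul p z = vmul z p.
Proof.
move=> red p z pP.
have inv q v : projection q -> z (q v) = q (z (q v)).
  move=> [_ qq]; pose a : M := vmul (vone M - q) (vmul z q).
  have a0 : a = 0.
    have qk w : q ((vone M - q) w) = 0.
      by rewrite !vE vD vN -[q (q w)]/(vmul q q w) qq subrr.
    apply: red; apply: vna_ext => u.
    by rewrite -[LHS]/((vone M - q) (z (q ((vone M - q) (z (q u)))))) qk !v0.
  apply/eqP; rewrite -subr_eq0; apply/eqP.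
  by rewrite -[LHS]/(a v) a0.
apply: vna_ext => v; rewrite !vE (inv p v pP).
have := inv (vone M - p) v (projection_compl pP); rewrite !vE !(vD, vN).
move=> /eqP; rewrite -subr_eq0 opprB addrC subrK => /eqP.
by move=> /eqP; rewrite subr_eq0 => /eqP.
Qed.

Lemma reduced_abelian : (forall a : M, vmul a a = 0 -> a = 0) -> abelian_vna M.
Proof.
move=> red x y.
have comm := central_comm (reduced_central red).
have h1 : vmul (x + vadj x) y = vmul y (x + vadj x).
  by apply: comm; rewrite vadjD vadjK addrC.
have h2 : vmul (ci *: (x - vadj x)) y = vmul y (ci *: (x - vadj x)).
  by apply: comm; rewrite vadjZ vadjD vadjN vadjK ciJ scaleNr -scalerN opprB.
have cc : (ci : R[i]) * ci = -1.
  by apply: complexP; rewrite !cE; ring.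
(* Cartesian decomposition: [x + vadj x] and [ci *: (x - vadj x)] are both self-adjoint. *)
have xE : x = (2^-1 : R)%:C *: ((x + vadj x) - ci *: (ci *: (x - vadj x))).
  rewrite scalerA cc scaleN1r opprK addrACA subrr addr0.
  rewrite -[x in X in _ = _ *: X]scale1r -scalerDl scalerA -(rmorph1 (real_complex R)).
  rewrite -rmorphD -rmorphM.
  have -> : (2^-1 : R) * (1 + 1) = 1 by field.
  by rewrite scale1r.
have : vmul x y = vmul y x.
  rewrite xE vmulZl vmulZr vmulDl vmulDr vmulNl vmulNr vmulZl vmulZr.
  by rewrite h1 h2.
by move=> /(congr1 (fun q : M => vna_op q)).
Qed.
End Commutative.

(** * Envelopes in the abelian case *)

Section Envelope.
Context {R : realType} {H : hilbertSpace R} {M : vonNeumannAlgebra H}.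
Implicit Types (x y z : M) (u v w : H).

Lemma unit_scale x : positive_operator x -> exists2 K : R, 0 < K & exists x1 : M,
  [/\ positive_operator x1, positive_operator (vone M - x1) & x = K%:C *: x1].
Proof.
move=> x0; have [K K0 hK] := vbounded x; exists K => //; exists (K^-1%:C *: x).
have K1 : 0 <= K^-1 by rewrite invr_ge0 ltW.
have KK : K^-1%:C * K%:C = 1 :> R[i] by rewrite -rmorphM mulVf // gt_eqF.
split; first exact: positive_scale.
  have := positive_scale K1 (positive_bound (ltW K0) x0 hK).
  by rewrite scalerBr scalerA KK scale1r.
by rewrite scalerA mulrC KK scale1r.
Qed.

Lemma positive_sum I (r : seq I) (e : I -> M) :
  (forall k, positive_operator (e k)) -> positive_operator (\sum_(k <- r) e k).
Proof.
move=> e0; apply: (big_ind (fun x : M => positive_operator x)) => // [v|x y x0 y0].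
  by rewrite inner0l.
exact: positive_add.
Qed.

(** A one-sided bound is enough, because the roles of [i] and [j] can be exchanged. Near maximality
    in [upper_envelope] provides exactly such a bound. *)
Lemma real_cauchy (a : nat -> R) (K : R) :
  (forall i j, a i - a j <= K * (i.+1%:R^-1 + j.+1%:R^-1)) -> cvgn a.
Proof.
move=> h; apply/cauchy_cvgP/cauchy_exP => e e0.
have K0 : 0 <= K.
  have := h 0%N 0%N; rewrite subrr invr1; nra.
have e2 : 0 < e / (2 * (K + 1)) by rewrite divr_gt0 // mulr_gt0 // ltr_wpDl.
have [N _ hN] := cvgr_lt _ (@cvg_harmonic R) _ e2.
have key n : (N <= n)%N -> K * (N.+1%:R^-1 + n.+1%:R^-1) < e.
  move=> Nn; have h1 : N.+1%:R^-1 < e / (2 * (K + 1)) := hN N (leqnn N).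
  have h2 : n.+1%:R^-1 < e / (2 * (K + 1)) := hN n Nn.
  apply: (@le_lt_trans _ _ (K * (e / (K + 1)))).
    rewrite ler_wpM2l //; apply: le_trans (ltW (ltrD h1 h2)) _.
    by rewrite le_eqVlt; apply/orP; left; apply/eqP; field; rewrite gt_eqF // ltr_wpDl.
  by rewrite mulrCA gtr_pMr // ltr_pdivrMr ?mul1r ?ltrDl ?ltr01 // ltr_wpDl.
exists (a N); exists N => //= n /= Nn.
rewrite -ball_normE /= ltr_norml; apply/andP; split.
  by rewrite ltrNl opprB; apply: le_lt_trans (h n N) _; rewrite [X in K * X]addrC; exact: key.
exact: le_lt_trans (h N n) (key n Nn).
Qed.

Lemma geometric_half m : \sum_(0 <= k < m) 2^-1 ^+ k <= 2 :> R.
Proof.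
suff -> : \sum_(0 <= k < m) 2^-1 ^+ k = 2 - 2 * 2^-1 ^+ m :> R.
  by rewrite gerBl mulr_ge0 // exprn_ge0 // invr_ge0.
elim: m => [|m ih]; first by rewrite big_nil expr0 mulr1 subrr.
by rewrite big_nat_recr //= ih exprS; field.
Qed.

Hypothesis abel : forall x y, vmul x y = vmul y x.
Variables (phi : predual M) (psi : nat -> order_interval phi) (psi0 : order_interval phi).
Hypothesis psi_cvg : forall k,
  (functional_norm (fun x : M => psi k x - psi0 x)%R < (2^-1 ^+ k)%:E)%E.

(** The weights form a partition of unity which vanishes from [N] on. Stating the sums for every [m]
    beyond [N] lets two mixtures be written with a common length. *)
Definition mixture n (f : M -> R[i]) := exists (N : nat) (e : nat -> M),
  [/\ forall k, positive_operator (e k),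
      forall m, (N <= m)%N -> \sum_(0 <= k < m) e k = vone M &
      forall m, (N <= m)%N -> forall x,
        f x = \sum_(0 <= k < m) psi (n + k) (vmul (e k) x)].

Lemma mixture_scalar n f : mixture n f -> scalar f.
Proof.
move=> [N [e [_ _ fE]]] a x y; rewrite !(fE N) // mulr_sumr -big_split.
by apply: eq_bigr => k _; rewrite vmulDr vmulZr itv_scalar.
Qed.

Lemma mixture_pos n f : mixture n f -> pos_fun f.
Proof.
move=> [N [e [e0 _ fE]]] x x0; rewrite (fE N) //; apply: sumr_ge0 => k _.
by apply/itv_pos/positive_mul.
Qed.

Lemma weights_sum (g : M -> R[i]) (e : nat -> M) m x : scalar g ->
  \sum_(0 <= k < m) e k = vone M -> g x = \sum_(0 <= k < m) g (vmul (e k) x).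
Proof.
move=> gL e1; rewrite -(fun_sum gL) -[x in LHS]vmul1l -e1.
congr g; elim: m {e1} => [|m ih]; first by rewrite !big_nil vmul0l.
by rewrite !big_nat_recr //= vmulDl ih.
Qed.

Lemma mixture_le n f (chi : M -> R[i]) : scalar chi -> mixture n f ->
  (forall k x, positive_operator x -> psi (n + k) x <= chi x) ->
  forall x, positive_operator x -> f x <= chi x.
Proof.
move=> chiL [N [e [e0 e1 fE]]] h x x0.
rewrite (fE N) // (weights_sum x chiL (e1 N (leqnn N))).
by apply: ler_sum => k _; apply/h/positive_mul.
Qed.

Lemma mixture_base n k : mixture n (psi (n + k)).
Proof.
exists k.+1, (fun j => if j == k then vone M else 0).
have sumE (V : zmodType) (F : nat -> V) m : (k < m)%N ->
    \sum_(0 <= j < m) (if j == k then F j else 0) = F k.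
  move=> km; rewrite -big_mkcond big_mkord (big_pred1 (Ordinal km)) //.
split=> [j|m km|m km x].
- by case: eqP => _; [exact: positive_one|move=> v; rewrite inner0l].
- by rewrite (sumE _ (fun=> vone M)).
- rewrite -[LHS](sumE _ (fun j => psi (n + j) x) _ km); apply: eq_bigr => j _.
  case: eqP => _; first by rewrite vmul1l.
  by rewrite vmul0l (fun0 (@itv_scalar _ _ _ _ _)).
Qed.

(** Mixtures are convex with coefficients in [M], not only in the scalars. This allows near
    maximality at 1 to be tested on any part 0 <= e <= 1. *)
Lemma mixture_step n f g (e : M) : mixture n f -> mixture n g ->
  positive_operator e -> positive_operator (vone M - e) ->
  mixture n (fun x => f (vmul e x) + g (vmul (vone M - e) x)).
Proof.
move=> [N [a [a0 a1 fE]]] [N' [b [b0 b1 gE]]] e0 e1.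
exists (maxn N N'), (fun k => vmul e (a k) + vmul (vone M - e) (b k)).
have sumM (c : M) (F : nat -> M) m :
    \sum_(0 <= k < m) vmul c (F k) = vmul c (\sum_(0 <= k < m) F k).
  elim: m => [|m ih]; first by rewrite !big_nil vmul0r.
  by rewrite !big_nat_recr //= vmulDr ih.
split=> [k|m|m].
- by apply: positive_add; exact: positive_mul.
- rewrite geq_max => /andP[Nm Nm'].
  by rewrite big_split /= !sumM a1 // b1 // !vmul1r addrC subrK.
- rewrite geq_max => /andP[Nm Nm'] x.
  rewrite (fE m) // (gE m) // -big_split; apply: eq_bigr => k _.
  rewrite [in RHS]vmulDl (funD (itv_scalar (psi (n + k)))).
  by rewrite [in RHS](abel _ (b k)) [in RHS](abel _ (a k)) !vmulA.
Qed.

(** The difference is the sum of (psi_(n+k) - psi0)(e_k). Each weight is a contraction, so the terms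
    are at most 2^-(n+k), with sum at most 2 * 2^-n. *)
Lemma mixture_bound n f : mixture n f ->
  complex.Re (f (vone M)) - complex.Re (psi0 (vone M)) <= 2 * 2^-1 ^+ n.
Proof.
move=> [N [e [e0 e1 fE]]]; have eN := e1 N (leqnn N).
rewrite (fE N) // (weights_sum (vone M) (@itv_scalar _ _ _ _ psi0) eN).
rewrite !(big_morph _ (@ReD R) (erefl _)) -sumrB.
apply: (@le_trans _ _ (\sum_(0 <= k < N) 2^-1 ^+ n * 2^-1 ^+ k)); last first.
  by rewrite -mulr_sumr mulrC ler_wpM2r ?exprn_ge0 ?invr_ge0 ?geometric_half.
rewrite big_nat [leRHS]big_nat; apply: ler_sum => k /= kN.
rewrite vmul1r -exprD.
have ek1 : positive_operator (vone M - e k).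
  rewrite -eN (big_cat_nat _ (n := k)) //=; last by rewrite ltnW.
  rewrite (big_cat_nat _ (m := k) (n := k.+1)) //= big_nat1.
  rewrite addrAC addrA subrK.
  by apply: positive_add; exact: positive_sum.
have := functional_norm_ge (psi_cvg (n + k)) (positive_le1_contract (e0 k) ek1).
move=> h; apply: ler_of_sqr; first by rewrite exprn_ge0 // invr_ge0.
by apply: le_trans (ltW h); rewrite /sqn !cE lerDl sqr_ge0.
Qed.
End Envelope.

Section Upper.
Context {R : realType} {H : hilbertSpace R} {M : vonNeumannAlgebra H}.
Implicit Types (x y z : M) (u v w : H).
Hypothesis abel : forall x y, vmul x y = vmul y x.
Variables (phi : predual M) (psi : nat -> order_interval phi) (psi0 : order_interval phi).
Hypothesis psi_cvg : forall k,
  (functional_norm (fun x : M => psi k x - psi0 x)%R < (2^-1 ^+ k)%:E)%E.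

Lemma itv_le_unit (f g : M -> R[i]) : scalar f -> scalar g ->
  (forall x, positive_operator x -> positive_operator (vone M - x) ->
     complex.Re (f x) <= complex.Re (g x)) ->
  forall x, positive_operator x -> complex.Re (f x) <= complex.Re (g x).
Proof.
move=> fL gL h x x0; have [K K0 [x1 [x10 x11 ->]]] := unit_scale x0.
by rewrite (funZ fL) (funZ gL) !cE !mul0r !subr0 ler_wpM2l ?(ltW K0) ?h.
Qed.

Lemma itv_le_complex (theta : predual M) (chi chi' : order_interval theta) x :
  (chi <= chi')%O -> positive_operator x -> chi x <= chi' x.
Proof. by move=> /asboolP; apply. Qed.

Lemma itv_le_top (theta : predual M) (chi : order_interval theta) x :
  positive_operator x -> chi x <= theta x.
Proof. by have [_ /asboolP] := set_mem (interval_in chi); apply. Qed.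

(* The supremum is the limit of mixtures [F j] that nearly maximize the value at 1:
   replacing part of [F j] by another mixture, along some [0 <= x <= 1], gains at
   most [1 / (j + 1)], so the [F j] converge and dominate every mixture in the
   limit. *)
Lemma upper_envelope n : exists z : order_interval phi,
  [/\ forall k, (psi (n + k) <= z)%O,
      forall chi : order_interval phi, (forall k, (psi (n + k) <= chi)%O) -> (z <= chi)%O &
      complex.Re (z (vone M)) - complex.Re (psi0 (vone M)) <= 2 * 2^-1 ^+ n].
Proof.
pose S := [set r : R | exists2 f, mixture psi n f & r = complex.Re (f (vone M))].
have one0 := @positive_one _ _ M.
have Ssup : has_sup S.
  split; first by exists (complex.Re (psi (n + 0) (vone M))), (psi (n + 0)) => //;
    exact: mixture_base.
  exists (complex.Re (psi0 (vone M)) + 2 * 2^-1 ^+ n) => _ [f fm ->].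
  by rewrite -lerBlDl; exact: (mixture_bound psi_cvg fm).
have Sub f : mixture psi n f -> complex.Re (f (vone M)) <= sup S.
  by move=> fm; apply: ub_le_sup; [case: Ssup|exists f].
have exf (j : nat) : exists f : order_interval phi, mixture psi n f /\
    sup S - j.+1%:R^-1 < complex.Re (f (vone M)).
  have j0 : 0 < j.+1%:R^-1 :> R by rewrite invr_gt0.
  have [_ [f fm ->] hf] := sup_adherent j0 Ssup.
  have [||x x0|chi chiE] := @itv_ex _ _ _ phi f.
  - exact: mixture_scalar fm.
  - exact: (mixture_pos abel fm).
  - apply: (mixture_le abel (predual_scalar phi) fm _ x0) => k y y0.
    exact: itv_le_top.
  exists chi; rewrite chiE; split=> //.
  by rewrite (_ : (chi : M -> R[i]) = f) //; apply/funext.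
have [F FP] := choice exf.
have Fbest g j x : mixture psi n g -> positive_operator x -> positive_operator (vone M - x) ->
    complex.Re (g x) <= complex.Re (F j x) + j.+1%:R^-1.
  move=> gm x0 x1; have [Fm Fsup] := FP j.
  have := Sub _ (mixture_step abel gm Fm x0 x1).
  rewrite !vmul1r (funD (itv_scalar (F j))) (funN (itv_scalar (F j))) !cE => h.
  by move: Fsup h; move: (j.+1%:R^-1) => d; lra.
have Fbest' x : positive_operator x -> exists2 K : R, 0 < K &
    forall g j, mixture psi n g -> complex.Re (g x) <= complex.Re (F j x) + K * j.+1%:R^-1.
  move=> x0; have [K K0 [x1 [x10 x11 ->]]] := unit_scale x0; exists K => // g j gm.
  rewrite (funZ (mixture_scalar gm)) (funZ (itv_scalar (F j))) !cE !mul0r !subr0.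
  by rewrite -mulrDr ler_wpM2l ?(ltW K0) ?Fbest.
have Fcvg x : positive_operator x -> cvgn (fun j => complex.Re (F j x)).
  move=> x0; have [K K0 hK] := Fbest' x x0; apply: (real_cauchy (K := K)) => i j.
  have [Fi _] := FP i; rewrite lerBlDl; apply: le_trans (hK _ j Fi) _.
  by rewrite lerD2l ler_wpM2l ?(ltW K0) // lerDr invr_ge0.
have [|z zE] := @itv_lim _ _ _ phi nat \oo _ F (fun x => limn (fun j => complex.Re (F j x))).
  by move=> x x0; exact: Fcvg.
exists z; split.
- move=> k; apply/itv_leP => x x0; rewrite zE //; have [K K0 hK] := Fbest' x x0.
  have h : (fun j => complex.Re (F j x) + K * j.+1%:R^-1) @ \oo -->
      limn (fun j => complex.Re (F j x)) + K * 0.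
    apply: cvgD; first exact: Fcvg.
    by apply: cvgMl_tmp; exact: (@cvg_harmonic R).
  rewrite mulr0 addr0 in h; apply: (cvgr_to_ge h); near=> j.
  by apply: hK; exact: mixture_base.
- move=> chi hchi; apply/itv_leP => x x0; rewrite zE //.
  apply: (cvgr_to_le (Fcvg x x0)); near=> j.
  have [Fm _] := FP j.
  have := mixture_le abel (itv_scalar chi) Fm (fun k y => itv_le_complex (hchi k)) x0.
  by rewrite lecE => /andP[].
- rewrite zE // lerBlDr; apply: (cvgr_to_le (Fcvg _ one0)); near=> j.
  by have [Fm _] := FP j; rewrite -lerBlDr; exact: (mixture_bound psi_cvg Fm).
Unshelve. all: by end_near. Qed.

(** [z n] is the least upper bound of the tail from [n]; tails shrink, so these decrease. *)
Lemma dominating_sequence : exists z : nat -> order_interval phi,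
  (forall k, (psi k <= z k)%O) /\ decreases_to z psi0.
Proof.
have [z zP] := choice upper_envelope.
have z_ge n k : (n <= k)%N -> (psi k <= z n)%O.
  by move=> nk; have [h _ _] := zP n; have := h (k - n)%N; rewrite subnKC.
have lim0 (C : R) : (fun n => C * 2^-1 ^+ n) @ \oo --> (0 : R).
  by rewrite -[X in _ --> X](mulr0 C); apply: cvgMl_tmp; exact: cvg_half.
(* Norm convergence preserves the inequality between [psi k], k >= n, and [z n]. *)
have psi0z n : (psi0 <= z n)%O.
  apply/itv_leP; apply: itv_le_unit (itv_scalar psi0) (itv_scalar (z n)) _ => x x0 x1.
  have h : (fun k => complex.Re (z n x) + 1 * 2^-1 ^+ k) @ \oo --> complex.Re (z n x) + 0.
    by apply: cvgD; [exact: cvg_cst|exact: lim0].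
  rewrite addr0 in h; apply: (cvgr_to_ge h); near=> k.
  have := functional_norm_ge (psi_cvg k) (positive_le1_contract x0 x1) => hk.
  have pz : complex.Re (psi k x) <= complex.Re (z n x).
    apply: (itv_leP _ _).1 x0; apply: z_ge; near: k; exact: nbhs_infty_ge.
  rewrite mul1r; apply: (@le_trans _ _ (complex.Re (psi k x) + 2^-1 ^+ k)).
    rewrite -lerBlDl; apply: ler_of_sqr; first by rewrite exprn_ge0 // invr_ge0.
    by apply: le_trans (ltW hk); rewrite /sqn !cE -sqrrN opprB lerDl sqr_ge0.
  by rewrite lerD2r.
exists z; split=> [k|]; first exact: z_ge.
split=> [m n mn|].
  have [_ h _] := zP n; apply: h => k; apply: z_ge.
  by apply: leq_trans mn _; exact: leq_addr.
split=> [_ [n _ <-]|w hw]; first exact: psi0z.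
apply/itv_leP; apply: itv_le_unit (itv_scalar w) (itv_scalar psi0) _ => x x0 x1.
have h : (fun k => complex.Re (psi0 x) + 2 * 2^-1 ^+ k) @ \oo --> complex.Re (psi0 x) + 0.
  by apply: cvgD; [exact: cvg_cst|exact: lim0].
rewrite addr0 in h; apply: (cvgr_to_ge h); near=> n.
have wz : complex.Re (w x) <= complex.Re (z n x).
  by apply: (itv_leP _ _).1 x0; apply: hw; exists n.
(* Positivity of [z n - psi0] at 1 - x bounds its value at x by its value at 1, hence by 2 * 2^-n;
   so a lower bound [w] of all [z n] is below [psi0]. *)
have zx1 := (itv_leP _ _).1 (psi0z n) _ x1.
have [_ _ zb] := zP n.
apply: le_trans wz _; move: zx1 zb.
rewrite !(funD (itv_scalar _)) !(funN (itv_scalar _)) !cE.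
by move: (2^-1 ^+ n) => d; lra.
Unshelve. all: by end_near. Qed.
End Upper.

(** * Comparison of the two topologies *)

Lemma functional_normN {R : realType} {H : hilbertSpace R} {M : vonNeumannAlgebra H}
    (f : M -> R[i]) : functional_norm (fun x => - f x) = functional_norm f.
Proof.
rewrite /functional_norm; congr (ereal_sup _).
by apply: eq_imagel => x _; rewrite normrN.
Qed.

(** If [U] is not norm-open at [psi0], points outside [U] can be chosen within 2^-k of [psi0]. They
    order converge to it, so order-closedness of the complement puts [psi0] outside [U]. *)
Lemma abelian_order_opens {R : realType} {H : hilbertSpace R} {M : vonNeumannAlgebra H}
    (phi : predual M) : (forall x y : M, vmul x y = vmul y x) ->
  order_opens (order_interval phi) `<=` norm_opens phi.
Proof.
move=> abel U oU psi0 Upsi0; apply: contrapT => h.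
have exk (k : nat) : exists psi : order_interval phi, ~ U psi /\
    (functional_norm (fun x : M => psi x - psi0 x)%R < (2^-1 ^+ k)%:E)%E.
  apply: contrapT => hk; apply: h; exists (2^-1 ^+ k).
    by rewrite exprn_gt0 // invr_gt0.
  move=> psi hpsi; apply: contrapT => nU; apply: hk; by exists psi.
have [psi psiP] := choice exk.
have [|z [psiz zdec]] := @dominating_sequence _ _ _ abel phi psi psi0.
  by move=> k; have [] := psiP k.
have [|z' [psiz' zdec']] := @dominating_sequence _ _ _ abel phi (fun k => itv_compl (psi k))
    (itv_compl psi0).
  move=> k; have [_] := psiP k; rewrite -functional_normN.
  rewrite (_ : (fun x => - (psi k x - psi0 x)) =
    (fun x => itv_compl (psi k) x - itv_compl psi0 x)) //.
  by apply/funext => x; rewrite !itv_complE; ring.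
suff : (~` U) psi0 by [].
apply: (oU _ nat psi psi0).
- split; first exact: (inhabits 0%N).
  by move=> m n; exists (maxn m n); rewrite !leEnat leq_maxl leq_maxr.
- by move=> k; have [] := psiP k.
(* The lower sequence is the reflection of the upper sequence built for the reflected functionals,
   whose distances to [itv_compl psi0] are the same. *)
- exists (@itv_compl _ _ _ phi \o z'), z; split=> //.
    move=> k; split=> //=.
    by rewrite -[psi k]itv_complK; exact: itv_compl_le.
  by rewrite -[psi0]itv_complK; exact: decreases_compl.
Qed.

Theorem theorem8 (R : realType) (H : hilbertSpace R)
    (M : vonNeumannAlgebra H) :
  abelian_vna M <->
  (forall phi : predual M, positive_functional phi ->
    norm_opens phi = order_opens (order_interval phi)).
Proof.
split=> [abel phi _|Heq]; last exact/reduced_abelian/no_nilpotent.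
apply/seteqP; split; first by move=> U; exact: norm_opens_order.
apply: abelian_order_opens => x y; apply: vna_ext => v.
exact: (congr1 (@^~ v) (abel x y)).
Qed.
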